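(* For integers $n \ge 1$ and $t \ge 0$, let $f(n,t)$ be the maximum of $\operatorname{rg}(G,c)$ over all simple graphs $G$ with $|V(G)| = n$ and $|E(G)| = 2t$ and all colourings $c$ of $E(G)$ in which every colour class has size exactly $2$. Then for all $n \ge 3$ and $t \le n$: $f(n,t) = \infty$ if $t \le n-2$; $f(n,t) = n-1$ if $t = n-1$; and $f(n,t) = \lceil n/2 \rceil$ if $t = n$.
   Context: For an edge-coloured graph $(G,c)$, a cycle is rainbow if its edges have pairwise distinct colours. The rainbow girth $\operatorname{rg}(G,c)$ is the length of a shortest rainbow cycle in $(G,c)$, and $\operatorname{rg}(G,c) = \infty$ if $(G,c)$ has no rainbow cycle. A colour class is the set of edges receiving a given colour (so a colouring with all classes of size $2$ of a graph with $2t$ edges uses $t$ colours).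
   Formalization: In the cases t = n-1 and t = n it is also assumed that 2t ≤ C(n,2); this excludes only (n,t) = (3,2), (3,3), (4,4), where no simple graph on n vertices has 2t edges and so the maximum f(n,t) is undefined. *)

(* Defs.v *)
From HB Require Import structures.
From mathcomp Require Import all_boot.
From mathcomp Require Import boolp.

Set Implicit Arguments.
Unset Strict Implicit.
Unset Printing Implicit Defensive.

Record sgraph (V : finType) := SGraph {
  adj : rel V;
  adj_sym : symmetric adj;
  adj_irrefl : irreflexive adj }.

Definition edges (V : finType) (G : sgraph V) : {set {set V}} :=
  [set [set p.1; p.2] | p : V * V & adj G p.1 p.2].

(* A colouring is a total function on sets of vertices; only its values on
   [edges G] are ever used. *)
Definition colour_class (V : finType) (C : eqType) (G : sgraph V)
    (c : {set V} -> C) (a : C) : {set {set V}} :=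
  [set e in edges G | c e == a].

(* Only the colours that are actually used have a colour class. *)
Definition classes_of_size2 (V : finType) (C : eqType) (G : sgraph V)
    (c : {set V} -> C) : Prop :=
  forall e, e \in edges G -> #|colour_class G c (c e)| = 2.

(* The edges of the cycle [p] are the pairs {x, next p x} for x in p. *)
Definition rainbow_cycle (V : finType) (C : eqType) (G : sgraph V)
    (c : {set V} -> C) (p : seq V) : bool :=
  [&& 3 <= size p, ucycleb (adj G) p
    & uniq [seq c [set x; next p x] | x <- p]].

Definition has_rainbow_cycle (V : finType) (C : eqType) (G : sgraph V)
    (c : {set V} -> C) (k : nat) : bool :=
  [exists p : k.-tuple V, rainbow_cycle G c p].

(* Extended naturals: [None] stands for infinity. *)
Definition enat := option nat.

Definition enat_le (x y : enat) : bool :=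
  match x, y with
  | _, None => true
  | None, Some _ => false
  | Some a, Some b => a <= b
  end.

Definition rainbow_girth (V : finType) (C : eqType) (G : sgraph V)
    (c : {set V} -> C) : enat :=
  if pselect (exists k, has_rainbow_cycle G c k) is left h
  then Some (ex_minn h) else None.

Definition rainbow_girth_value (n t : nat) (v : enat) : Prop :=
  exists (V : finType) (C : eqType) (G : sgraph V) (c : {set V} -> C),
    [/\ #|V| = n, #|edges G| = 2 * t, classes_of_size2 G c
      & rainbow_girth G c = v].

(* [is_f n t v] is "f(n,t) = v", for f(n,t) the maximum of the rainbow girth.
   The maximum is a relation because it does not exist when 2t > 'C(n, 2). *)
Definition is_f (n t : nat) (v : enat) : Prop :=
  rainbow_girth_value n t v /\
  forall w, rainbow_girth_value n t w -> enat_le w v.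

Lemma rainbow_girth_value_bin2 (n t : nat) (v : enat) :
  rainbow_girth_value n t v -> 2 * t <= 'C(n, 2).
Proof.
case=> V [C] [G] [c] [<- <- _ _].
rewrite -card_draws; apply/subset_leq_card/subsetP => e.
case/imsetP=> -[x y]; rewrite inE /= => xy ->.
rewrite inE cards2; suff -> : x != y by [].
by apply/eqP => exy; rewrite exy adj_irrefl in xy.
Qed.

Lemma is_f_inj (n t : nat) (v w : enat) : is_f n t v -> is_f n t w -> v = w.
Proof.
case=> hv mv [hw mw]; move: (mv _ hw) (mw _ hv).
case: v w {hv mv hw mw} => [a|] [b|] //= h1 h2.
by congr Some; apply/eqP; rewrite eqn_leq h1 h2.
Qed.

(* Main.v *)
(** A graph with classes of size 2 is treated as a multigraph on m vertices in
    which each of m colours carries two edges, and the claim proved is that it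
    has a closed rainbow walk of length at most (m + p + 1) / 2, where p counts
    the colours whose two edges are parallel.  The case p = 0 is the bound for
    t = n.  For t = n - 1 some vertex v is not common to the two edges of any
    colour; keeping from every colour one edge that misses v, taken twice,
    gives m = p = n - 1.

    The claim goes by induction on m.  If some colour is parallel, its edge is
    grown to a maximal cluster of small rainbow diameter and contracted.  If
    p = 0 and m is odd, an edge of one colour is replaced by a copy of the
    other.  If p = 0 and m is even, then in a counterexample deleting a vertex
    set S, and bundling in pairs the colours that lose one edge, shows that a
    set touching few edges kills many colours (a colour is dead if both of its
    edges touch S).  Hence the graph is 4-regular.  If every vertex is the
    common vertex of the two edges of some colour, a largest set touching few
    edges is contradictory.  Otherwise a largest S touching at most 3|S| + 1
    edges and killing fewer than |S| colours must be a single vertex v, and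
    contracting the closed neighbourhood of v creates no parallel colour.

    The extremal examples assign two out-neighbours to each vertex of a set D
    and colour an arc by its tail: every vertex of a rainbow cycle is then a
    tail, so it lies in D and has an out-neighbour on the cycle. *)

Require Import Defs.
From mathcomp Require Import all_boot.
From mathcomp Require Import boolp zify.

Set Implicit Arguments.
Unset Strict Implicit.
Unset Printing Implicit Defensive.

(** Doubled length is the currency. Contracting a cluster of q vertices removes q - 1 vertices and q
    - 1 colours, while repairing a closed walk costs up to 2 * (q / 2) <= q. For even q this is one
    unit too much, and the term p pays it: the parallel colour disappears and, by maximality of the
    cluster, none arises. With p = 0 and m even there is nothing to pay with, so the final
    contraction is exact: five vertices, four colours, diameter two. The tool that leads there is
    deletion. If S has s vertices, kills d colours and takes one edge from h others, then s - d
    bundles are affordable, each lowering p by two, and the bound survives when h - 2 (s - d) <= s,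
    that is, when h + 2 d <= 3 s; here h + 2 d is the number of edges that S touches. A single
    vertex touches four edges, which is 3 s + 1 for s = 1; so the extremal sets are taken just above
    the threshold of deletion. *)

Lemma subset_of_card (A : finType) (B : {set A}) k : k <= #|B| ->
  exists2 B' : {set A}, B' \subset B & #|B'| = k.
Proof.
move=> le; exists [set c in take k (enum B)].
  by apply/subsetP => c; rewrite inE => /mem_take; rewrite mem_enum.
rewrite cardsE; have /card_uniqP -> : uniq (take k (enum B)) by rewrite take_uniq // enum_uniq.
by rewrite size_take -cardE; case: ltngtP le => // ->.
Qed.

(** * Rainbow closed walks and contraction *)

Section Walks.
Variables T C : finType.
Implicit Types (E : C -> bool -> T * T) (K D : {set C}) (x y z : T).

(* A step is (colour, which edge of the colour, direction of traversal). *)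
Definition step := (C * bool * bool)%type.
Implicit Types (s : step) (l : seq step).

Definition col s := s.1.1.
Definition src E s := if s.2 then (E s.1.1 s.1.2).2 else (E s.1.1 s.1.2).1.
Definition tgt E s := if s.2 then (E s.1.1 s.1.2).1 else (E s.1.1 s.1.2).2.
Definition flip s : step := (s.1, ~~ s.2).

Fixpoint walk E x l y :=
  if l is s :: l' then (src E s == x) && walk E (tgt E s) l' y else x == y.

Definition rainbow K l := uniq (map col l) && all (mem K) (map col l).

(* [B] bounds twice the length, so that half-integral bounds need no rounding. *)
Definition rcyc E K B := exists x l,
  [/\ walk E x l x, rainbow K l, l != [::] & (size l).*2 <= B].

Lemma src_flip E s : src E (flip s) = tgt E s.
Proof. by rewrite /src /tgt /=; case: s.2. Qed.

Lemma tgt_flip E s : tgt E (flip s) = src E s.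
Proof. by rewrite /src /tgt /=; case: s.2. Qed.

Lemma walk_cat E x y z l1 l2 :
  walk E x l1 y -> walk E y l2 z -> walk E x (l1 ++ l2) z.
Proof.
elim: l1 x => [|s l1 IH] x /=; first by move/eqP->.
by case/andP=> -> /IH; apply.
Qed.

Lemma walk_catP E x z l1 l2 :
  walk E x (l1 ++ l2) z -> exists2 y, walk E x l1 y & walk E y l2 z.
Proof.
elim: l1 x => [|s l1 IH] x /=; first by exists x.
by case/andP=> -> /IH [y w1 w2]; exists y.
Qed.

Lemma col_rev l : map col (rev (map flip l)) = rev (map col l).
Proof. by rewrite map_rev -map_comp. Qed.

Lemma rainbow_rev K l : rainbow K (rev (map flip l)) = rainbow K l.
Proof. by rewrite /rainbow col_rev rev_uniq all_rev. Qed.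

Lemma rainbow_catl K l1 l2 : rainbow K (l1 ++ l2) -> rainbow K l1.
Proof. by rewrite /rainbow map_cat cat_uniq all_cat => /andP[/and3P[-> _ _] /andP[->]]. Qed.

Lemma rainbow_catr K l1 l2 : rainbow K (l1 ++ l2) -> rainbow K l2.
Proof. by rewrite /rainbow map_cat cat_uniq all_cat => /andP[/and3P[_ _ ->] /andP[_ ->]]. Qed.

Lemma rainbow_catC K l1 l2 : rainbow K (l1 ++ l2) = rainbow K (l2 ++ l1).
Proof. by rewrite /rainbow !map_cat uniq_catC !all_cat andbC [in RHS]andbC (andbC (all _ _)). Qed.

Lemma rainbow_sub K K' l : K \subset K' -> rainbow K l -> rainbow K' l.
Proof.
move=> /subsetP sub /andP[u /allP a]; rewrite /rainbow u /=.
by apply/allP => c /a /sub.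
Qed.

Lemma rainbow_cat K D l1 l2 : [disjoint K & D] ->
  rainbow K l1 -> rainbow D l2 -> rainbow (K :|: D) (l1 ++ l2).
Proof.
move=> dis /andP[u1 /allP a1] /andP[u2 /allP a2].
rewrite /rainbow map_cat cat_uniq u1 u2 andbT /= all_cat; apply/and3P; split.
- apply/hasPn => c /a2 /= cD; apply/negP => /a1 /= cK.
  by rewrite (disjointFr dis cK) in cD.
- by apply/allP => c /a1 /= cK; rewrite inE cK.
- by apply/allP => c /a2 /= cD; rewrite inE cD orbT.
Qed.

Lemma rcyc_mono E K K' B B' : K \subset K' -> B <= B' -> rcyc E K B -> rcyc E K' B'.
Proof.
move=> sK leB [x] [l] [w r n s]; exists x, l; split=> //; first exact: rainbow_sub r.
exact: leq_trans leB.
Qed.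

(** Doubled lengths are even, so an odd bound has a unit to spare. *)
Lemma rcyc_parity E K B : ~~ odd B -> rcyc E K B.+1 -> rcyc E K B.
Proof.
move=> oB [x] [l] [w r n s]; exists x, l; split=> //.
have: (size l).*2 != B.+1 by apply: contraNneq oB => /(congr1 odd); rewrite odd_double /= => /esym/negbFE->.
by lia.
Qed.

Lemma rcyc1 E K s : col s \in K -> src E s = tgt E s -> rcyc E K 2.
Proof.
move=> cK e; exists (src E s), [:: s]; rewrite /= /rainbow /= -e !eqxx cK; split=> //.
Qed.

Lemma rcyc2 E K s1 s2 : col s1 \in K -> col s2 \in K -> col s1 != col s2 ->
  tgt E s1 = src E s2 -> tgt E s2 = src E s1 -> rcyc E K 4.
Proof.
move=> c1 c2 ne e1 e2; exists (src E s1), [:: s1; s2].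
by rewrite /= /rainbow /= inE ne c1 c2 e1 e2 !eqxx.
Qed.

Lemma rcyc3 E K s1 s2 s3 : col s1 \in K -> col s2 \in K -> col s3 \in K ->
  col s1 != col s2 -> col s2 != col s3 -> col s1 != col s3 ->
  tgt E s1 = src E s2 -> tgt E s2 = src E s3 -> tgt E s3 = src E s1 -> rcyc E K 6.
Proof.
move=> c1 c2 c3 n1 n2 n3 e1 e2 e3; exists (src E s1), [:: s1; s2; s3].
by rewrite /= /rainbow /= !inE negb_or n1 n2 n3 c1 c2 c3 e1 e2 e3 !eqxx.
Qed.

Lemma src_split E v l : v \in map (src E) l ->
  exists l1 s l2, [/\ l = l1 ++ s :: l2, src E s = v & v \notin map (src E) l1].
Proof.
elim: l => // s l IH; rewrite inE; case: (eqVneq v (src E s)) => [e _|ne /= /IH].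
  by exists [::], s, l.
case=> l1 [s'] [l2] [-> e n]; exists (s :: l1), s', l2; split=> //.
by rewrite inE negb_or ne.
Qed.

(** Rotating the walk to start at [v] and cutting it at the next departure from [v] leaves a single
    visit. This matters because the colours reserved for repairing a contraction can be spent only
    once. *)
Lemma closed_walk_once E K x l v : walk E x l x -> rainbow K l -> l != [::] ->
  exists y l', [/\ walk E y l' y, rainbow K l', l' != [::], size l' <= size l &
    (v \notin map (src E) l') \/ (y = v /\ v \notin map (src E) (behead l'))].
Proof.
move=> w r n; case vin: (v \in map (src E) l); last first.
  by exists x, l; split=> //; left; rewrite vin.
have [l1 [s [l2 [el es _]]]] := src_split vin.
move: w; rewrite {1}el => /walk_catP [y w1 w2].
have wv : walk E v (s :: (l2 ++ l1)) v.
  move: w2 => /= /andP[/eqP ey w2]; rewrite es eqxx /=; apply: walk_cat w2 _.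
  by rewrite -es ey.
have rv : rainbow K (s :: (l2 ++ l1)) by rewrite -cat_cons rainbow_catC -el.
have sv : size (s :: (l2 ++ l1)) <= size l by rewrite el /= !size_cat /=; lia.
case vin2: (v \in map (src E) (l2 ++ l1)); last first.
  by exists v, (s :: (l2 ++ l1)); split=> //; right; rewrite vin2.
have [k1 [s' [k2 [ek es' nk]]]] := src_split vin2.
move: wv rv sv; rewrite ek -cat_cons => /walk_catP [z wa wb] rv sv.
move: wb => /= /andP[/eqP ez _].
exists v, (s :: k1); split=> //.
- by move: wa; rewrite -ez es'.
- exact: rainbow_catl rv.
- by apply: leq_trans sv; rewrite size_cat leq_addr.
- by right.
Qed.

(** Doubling, bundling and replacing a deleted edge are all instances: [f] may send the two edges of
    a new colour to different old colours, as long as different new colours never share an old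
    one. *)
Lemma rcyc_relabel E E' K K' B (f : C -> bool -> C * bool) :
  (forall c b, c \in K' -> E' c b = E (f c b).1 (f c b).2) ->
  (forall c b, c \in K' -> (f c b).1 \in K) ->
  (forall c b c' b', c \in K' -> c' \in K' -> (f c b).1 = (f c' b').1 -> c = c') ->
  rcyc E' K' B -> rcyc E K B.
Proof.
move=> Ef fK finj [x] [l] [w /andP[u a] n s].
pose g s : step := (f s.1.1 s.1.2, s.2).
exists x, (map g l); split; last by rewrite size_map.
- move: {1 3}x w a => y; elim: l y {u n s} => [|s l IH] y //= /andP[/eqP <- w] /andP[sK a].
  rewrite /src /tgt /= -!Ef // eqxx /=.
  exact: IH.
- rewrite /rainbow -map_comp; apply/andP; split.
    elim: l u a {w n s} => //= s l IH /andP[sn u] /andP[sK a].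
    rewrite IH // andbT; apply: contra sn => /mapP [s' s'l e].
    rewrite (_ : col s = col s'); first exact: map_f.
    apply: finj e => //; exact: (allP a _ (map_f _ s'l)).
  apply/allP => _ /mapP [s' s'l ->] /=; apply: fK; exact: (allP a _ (map_f _ s'l)).
- by case: l n {w u a s}.
Qed.

Definition contract (Q : {set T}) (q0 : T) (x : T) := if x \in Q then q0 else x.
Definition contractE E Q q0 c b := (contract Q q0 (E c b).1, contract Q q0 (E c b).2).

Lemma contract_src E Q q0 s : src (contractE E Q q0) s = contract Q q0 (src E s).
Proof. by rewrite /src /=; case: s.2. Qed.

Lemma contract_tgt E Q q0 s : tgt (contractE E Q q0) s = contract Q q0 (tgt E s).
Proof. by rewrite /tgt /=; case: s.2. Qed.

(* A closed walk passing through [q0] only once is repaired by a single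
   connecting walk of length at most [d]. *)
Lemma rcyc_contract E K D (Q : {set T}) q0 d B : q0 \in Q -> D \subset K ->
  (forall a b, a \in Q -> b \in Q ->
     exists l, [/\ walk E a l b, rainbow D l & size l <= d]) ->
  rcyc (contractE E Q q0) (K :\: D) B -> rcyc E K (B + d.*2).
Proof.
move=> q0Q DK conn [x0] [l0] [w0 r0 n0 s0].
have [x [l [w r n s]]] := closed_walk_once q0 w0 r0 n0.
have sB : (size l).*2 <= B by apply: leq_trans s0; rewrite leq_double.
(* A segment with no departure from [q0] that does not end there meets only vertices on which the
   contraction is the identity, so the same steps form a walk before contraction. *)
have lift1 y z k : q0 \notin map (src (contractE E Q q0)) k -> walk (contractE E Q q0) y k z -> k != [::] -> z != q0 ->
    walk E y k z.
  elim: k y => // s1 k IH y /=; rewrite inE negb_or => /andP[h1 h2].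
  rewrite contract_src => /andP[/eqP ey wk] _ zq.
  have e1 : src E s1 = y.
    by move: h1; rewrite -ey contract_src /contract; case: ifP => // _; rewrite eqxx.
  rewrite e1 eqxx /=; case: k wk IH h2 => [|s2 k] wk IH h2.
    move: wk => /= /eqP ez; rewrite -ez contract_tgt /contract; case: ifP => //.
    by move=> tQ; move: zq; rewrite -ez contract_tgt /contract tQ eqxx.
  have tq : contract Q q0 (tgt E s1) = tgt E s1.
    move: (wk) h2 => /= /andP[/eqP e2 _]; rewrite inE negb_or e2 => /andP[h _].
    move: h; rewrite contract_tgt /contract; case: ifP => //; by rewrite eqxx.
  by apply: IH => //; rewrite -tq -contract_tgt.
case=> [nin|[ex nin]].
  exists x, l; split=> //.
  - apply: lift1 => //; case: l w nin n {r s sB} => // s1 l /= /andP[/eqP <- _].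
    by rewrite inE negb_or => /andP[+ _]; rewrite eq_sym.
  - by apply: rainbow_sub r; apply: subsetDl.
  - by apply: leq_trans sB _; apply: leq_addr.
case: l w r n s sB nin => // s1 l w r _ s sB nin; subst x.
(* Before contraction the walk leaves [Q] at one vertex and may come back at another one, [a]; a
   connecting walk with colours in [D] closes this gap. *)
have [a aQ wa] : exists2 b, b \in Q & walk E (src E s1) (s1 :: l) b.
  move: w => /= /andP[_]; rewrite eqxx /= => w.
  case: (lastP l) w nin => [|k s2] w nin.
    move: w => /= /eqP; rewrite contract_tgt /contract; case: ifP => [tQ _|nQ e].
      by exists (tgt E s1).
    by exists q0 => //; rewrite -e /=.
  move: w nin; rewrite -cats1 map_cat mem_cat negb_or /= inE.
  move=> /walk_catP [y w1] /= /andP[/eqP e2 /eqP e3] /andP[nk n2].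
  have yq : y != q0 by rewrite -e2 eq_sym.
  have ey : y = src E s2.
    by move: yq; rewrite -e2 contract_src /contract; case: ifP => //; rewrite eqxx.
  have tQ : tgt E s2 \in Q.
    by move: e3; rewrite contract_tgt /contract; case: ifP => // /negP h e; case: h; rewrite e.
  exists (tgt E s2) => //; apply: (@walk_cat _ _ y); last by rewrite /= ey !eqxx.
  case: k w1 nk {s sB r} => [|s3 k] w1 nk.
    move: w1 => /= /eqP; rewrite contract_tgt /contract; case: ifP => [_ e|_ ->] //.
    by move: yq; rewrite -e eqxx.
  have tq : tgt (contractE E Q q0) s1 = tgt E s1.
    move: (w1) nk => /= /andP[/eqP e4 _]; rewrite inE negb_or e4 => /andP[h _].
    move: h; rewrite contract_tgt /contract; case: ifP => //; by rewrite eqxx.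
  by rewrite -tq; apply: lift1.
have bQ : src E s1 \in Q.
  move: w => /= /andP[/eqP]; rewrite contract_src /contract; case: ifP => // /negP h e.
  by case: h; rewrite e.
have [k [wk rk sk]] := conn _ _ aQ bQ.
exists (src E s1), (s1 :: l ++ k); split=> //.
- by rewrite -cat_cons; apply: walk_cat wa wk.
- rewrite -cat_cons; apply: rainbow_sub (rainbow_cat _ r rk).
    by rewrite subUset subsetDl DK.
  by rewrite disjoint_sym; apply/pred0P => c /=; rewrite inE; case: (c \in D).
- rewrite -cat_cons size_cat doubleD; apply: leq_add => //; by rewrite leq_double.
Qed.

End Walks.
Arguments col {C} s.

(** * Clusters *)

Section Cluster.
Variables T C : finType.
Implicit Types (E : C -> bool -> T * T) (K D : {set C}) (x y z : T) (X Q : {set T}).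

Definition edges_in E K X :=
  forall c b, c \in K -> (E c b).1 \in X /\ (E c b).2 \in X.

Definition same_ends (p q : T * T) := (p == q) || (p == (q.2, q.1)).

Definition parallel E c := same_ends (E c false) (E c true).

Definition num_parallel E K := #|[set c in K | parallel E c]|.

Lemma edges_in_sub E K K' X : K' \subset K -> edges_in E K X -> edges_in E K' X.
Proof. by move=> /subsetP s h c b /s; apply: h. Qed.

Lemma src_in E K X s : edges_in E K X -> col s \in K -> src E s \in X.
Proof. by move=> h /h hs; rewrite /src; case: s.2; case: (hs s.1.2). Qed.

Lemma tgt_in E K X s : edges_in E K X -> col s \in K -> tgt E s \in X.
Proof. by move=> h /h hs; rewrite /tgt; case: s.2; case: (hs s.1.2). Qed.

Lemma contract_edges_in E K X Q q0 : q0 \in Q -> Q \subset X -> edges_in E K X ->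
  edges_in (contractE E Q q0) K (q0 |: (X :\: Q)).
Proof.
move=> q0Q QX h c b /(h c b)[h1 h2]; rewrite /contractE /contract /= !inE.
by split; case: ifP => //; rewrite ?eqxx // => ->; rewrite ?h1 ?h2 orbT.
Qed.

Lemma card_contract X Q q0 : q0 \in Q -> Q \subset X ->
  #|q0 |: (X :\: Q)| + #|Q| = #|X|.+1.
Proof.
move=> q0Q QX; rewrite cardsU1 !inE q0Q /= add1n addSn; congr _.+1.
by rewrite cardsD (setIidPr QX) subnK // subset_leq_card.
Qed.

(** Contracting an edge and dropping its colour preserves |X| <= |K|, so a loop appears at the
    latest when one vertex is left. The bound stays unspecified because only the existence of a
    cycle is used later. *)
Lemma basic_cycle E K X : edges_in E K X -> 0 < #|X| -> #|X| <= #|K| ->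
  exists B, rcyc E K B.
Proof.
have [n] := ubnP #|X|; elim: n E K X => // n IH E K X ltn hE X0 XK.
have [c cK] : exists c, c \in K by apply/set0Pn; rewrite -card_gt0; lia.
have [e|ne] := eqVneq (E c false).1 (E c false).2.
  by exists 2; apply: (@rcyc1 _ _ _ _ (c, false, false)).
set a := (E c false).1 in ne; set b := (E c false).2 in ne.
have [aX bX] := hE c false cK.
have QX : [set a; b] \subset X by apply/subsetP => z; rewrite !inE => /orP[] /eqP ->.
have aQ : a \in [set a; b] by rewrite !inE eqxx.
have cd := card_contract aQ QX; rewrite cards2 ne in cd.
have [] := IH (contractE E [set a; b] a) (K :\ c) (a |: (X :\: [set a; b])).
- by lia.
- by apply: edges_in_sub (subD1set _ _) _; apply: contract_edges_in.
- by rewrite cardsU1 !inE eqxx.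
- by have := cardsD1 c K; rewrite cK; lia.
move=> B rB; exists (B + 1.*2); apply: (rcyc_contract aQ (_ : [set c] \subset K)) rB.
  by rewrite sub1set.
have st o : rainbow [set c] [:: (c, false, o)] by rewrite /rainbow /= inE eqxx.
move=> x y; rewrite !inE => /orP[]/eqP-> /orP[]/eqP->.
- by exists [::]; rewrite /= eqxx.
- by exists [:: (c, false, false)]; rewrite /= st /src /tgt /= !eqxx.
- by exists [:: (c, false, true)]; rewrite /= st /src /tgt /= !eqxx.
- by exists [::]; rewrite /= eqxx.
Qed.

Definition reach E D Q y i :=
  [set a in Q | `[< exists l, [/\ walk E y l a, rainbow D l & size l <= i] >]].

Lemma reachP E D Q y i a : reflect
  (a \in Q /\ exists l, [/\ walk E y l a, rainbow D l & size l <= i])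
  (a \in reach E D Q y i).
Proof. by rewrite inE; apply: (iffP andP) => -[? /asboolP]. Qed.

Lemma reach_sub E D Q y i : reach E D Q y i \subset Q.
Proof. by apply/subsetP => a /reachP[]. Qed.

Lemma reach_mono E D D' Q Q' y i : D \subset D' -> Q \subset Q' ->
  reach E D Q y i \subset reach E D' Q' y i.
Proof.
move=> sD /subsetP sQ; apply/subsetP => a /reachP[aQ [l [w r s]]]; apply/reachP.
by split; [apply: sQ | exists l; split=> //; apply: rainbow_sub r].
Qed.

Lemma reach_refl E D Q y i : y \in Q -> y \in reach E D Q y i.
Proof. by move=> yQ; apply/reachP; split=> //; exists [::]; rewrite /= eqxx. Qed.

Lemma rainbow_rcons K D s l : col s \in K -> col s \notin D -> D \subset K ->
  rainbow D l -> rainbow K (rcons l s).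
Proof.
move=> sK sD /subsetP DK /andP[u /allP a]; rewrite /rainbow map_rcons rcons_uniq u.
rewrite all_rcons andbT /= sK /= andbC; apply/andP; split.
  by apply/allP => c /a /DK.
by apply: contra sD => /a.
Qed.

Lemma reach_last E D Q y i s c : tgt E s \in reach E D Q y i -> col s = c -> c \notin D ->
  src E s \in reach E (c |: D) (src E s |: Q) y i.+1.
Proof.
move=> /reachP[tQ [l [w r sz]]] ec cD; apply/reachP; rewrite setU11; split=> //.
exists (rcons l (flip s)); split; last by rewrite size_rcons.
- by rewrite -cats1; apply: walk_cat w _; rewrite /= src_flip tgt_flip !eqxx.
- apply: rainbow_rcons r; last exact: subsetUr.
    by rewrite /flip /col /= -/(col s) ec setU11.
  by rewrite /flip /col /= -/(col s) ec.
Qed.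

Lemma reach_first E D Q w i s c : src E s = w -> col s = c -> c \notin D ->
  reach E D Q (tgt E s) i \subset reach E (c |: D) (w |: Q) w i.+1.
Proof.
move=> sw ec cD; apply/subsetP => a /reachP[aQ [l [wl r sz]]]; apply/reachP.
rewrite inE aQ orbT; split=> //; exists (s :: l); split=> //.
- by rewrite /= sw eqxx.
- rewrite -rainbow_rev /= rev_cons; apply: rainbow_rcons; last by rewrite rainbow_rev; apply: r.
  + by rewrite /flip /col /= -/(col s) ec setU11.
  + by rewrite /flip /col /= -/(col s) ec.
  + exact: subsetUr.
Qed.

Lemma minnSS q j a r : minn q j <= a -> a < r -> minn q.+1 j.+1 <= r.
Proof. by lia. Qed.

Lemma minnS_le q j a r : j <= q -> minn q j <= a -> a <= r -> minn q.+1 j <= r.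
Proof. by lia. Qed.

Lemma minn_miss q j a : q < j.+2 -> minn q j <= a -> q <= a.+1.
Proof. by lia. Qed.

Lemma full_sub (A Q : {set T}) : A \subset Q -> #|Q| <= #|A| -> A = Q.
Proof. by move=> s le; apply/eqP; rewrite eqEcard s. Qed.

Lemma miss_one (A Q : {set T}) a b : A \subset Q -> #|Q| <= #|A|.+1 -> a \in Q -> b \in Q ->
  a != b -> a \in A \/ b \in A.
Proof.
move=> s le aQ bQ ab; case aA: (a \in A); first by left.
case bA: (b \in A); first by right.
have: A \subset Q :\ a :\ b.
  apply/subsetP => z zA; rewrite !inE (subsetP s _ zA) andbT.
  by apply/andP; split; apply: contraTneq zA => ->; rewrite ?aA ?bA.
move/subset_leq_card; have := cardsD1 a Q; have := cardsD1 b (Q :\ a).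
by rewrite aQ !inE bQ eq_sym ab /=; lia.
Qed.

(* [Q] is grown from an edge by adding vertices that both edges of some colour
   join to [Q]; this makes balls grow at least as fast as on the square of a
   path, which is what the last two clauses say. *)
Definition cluster E X K c0 Q D :=
  [/\ [/\ Q \subset X, D \subset K, c0 \in D & #|Q| = #|D|.+1],
      forall c, c \in D -> c != c0 -> ~~ parallel E c,
      forall y i, y \in Q -> minn #|Q| i.*2.+1 <= #|reach E D Q y i| &
      forall y z i, y \in Q -> z \in Q -> y != z ->
        minn #|Q| i.*2.+2 <= #|reach E D Q y i :|: reach E D Q z i|].

Lemma cluster_edge E X K c0 : edges_in E K X -> c0 \in K ->
  (E c0 false).1 != (E c0 false).2 ->
  cluster E X K c0 [set (E c0 false).1; (E c0 false).2] [set c0].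
Proof.
move=> hE cK ne; have [aX bX] := hE c0 false cK.
set a := (E c0 false).1 in ne aX *; set b := (E c0 false).2 in ne bX *.
set Q := [set a; b]; have cQ : #|Q| = 2 by rewrite cards2 ne.
have st o : rainbow [set c0] [:: (c0, false, o)] by rewrite /rainbow /= inE eqxx.
have full y i : y \in Q -> 0 < i -> reach E [set c0] Q y i = Q.
  move=> yQ i0; apply/eqP; rewrite eqEsubset reach_sub; apply/subsetP => z zQ.
  apply/reachP; split=> //.
  move: yQ zQ; rewrite !inE => /orP[]/eqP-> /orP[]/eqP->.
  - by exists [::]; rewrite /= eqxx.
  - by exists [:: (c0, false, false)]; rewrite /= st /src /tgt /= !eqxx.
  - by exists [:: (c0, false, true)]; rewrite /= st /src /tgt /= !eqxx.
  - by exists [::]; rewrite /= eqxx.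
split.
- split; rewrite ?sub1set ?inE ?eqxx ?cards1 ?cQ //.
  by apply/subsetP => z; rewrite !inE => /orP[] /eqP ->.
- by move=> c; rewrite inE => ->.
- move=> y [|i] yQ; last by rewrite full // geq_minl.
  apply: leq_trans (geq_minr _ _) _; rewrite card_gt0; apply/set0Pn.
  by exists y; apply: reach_refl.
- move=> y z i yQ zQ yz; apply: leq_trans (geq_minl _ _) _; rewrite cQ.
  have <- : #|[set y; z]| = 2 by rewrite cards2 yz.
  apply: subset_leq_card; apply/subsetP => u; rewrite in_set2 in_setU.
  by case/orP => /eqP ->; rewrite reach_refl ?orbT.
Qed.

(** The new vertex [w] has two neighbours in [Q] along the new colour. Seen from [w], balls contain
    the union of the balls about these neighbours; seen from [Q], a ball that misses at most one
    vertex contains one of the neighbours and reaches [w] in the next step. Every walk built uses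
    the new colour once, so it stays rainbow. *)
Lemma cluster_extend E X K c0 Q D c s1 s2 :
  cluster E X K c0 Q D -> c \in K -> c \notin D -> ~~ parallel E c ->
  col s1 = c -> col s2 = c -> src E s1 = src E s2 -> src E s1 \in X :\: Q ->
  tgt E s1 \in Q -> tgt E s2 \in Q -> tgt E s1 != tgt E s2 ->
  cluster E X K c0 (src E s1 |: Q) (c |: D).
Proof.
move=> [[QX DK c0D cQ] np BG G2] cK cD nc e1 e2 ew; rewrite inE => /andP[wQ wX] aQ bQ ab.
set w := src E s1 in ew wQ wX *.
have rm y i := subset_leq_card (reach_mono E y i (subsetUr [set c] D) (subsetUr [set w] Q)).
have wlast y i : tgt E s1 \in reach E D Q y i \/ tgt E s2 \in reach E D Q y i ->
    w \in reach E (c |: D) (w |: Q) y i.+1.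
  by case=> h; [|rewrite ew]; apply: reach_last h _ _.
have cw : #|w |: Q| = #|Q|.+1 by rewrite cardsU1 wQ.
have sR y i : reach E (c |: D) (w |: Q) y i \subset w |: Q by apply: reach_sub.
have Q2 : 1 < #|Q| by rewrite cQ ltnS card_gt0; apply/set0Pn; exists c0.
split.
- split; rewrite ?subUset ?sub1set ?wX ?QX ?cK ?DK //.
  + by rewrite inE c0D orbT.
  + by rewrite cw cQ cardsU1 cD.
- move=> c'; rewrite !inE => /orP[/eqP -> //|]; exact: np.
- move=> y i /setU1P[->|yQ].
    case: i => [|i].
      apply: leq_trans (geq_minr _ _) _; rewrite card_gt0; apply/set0Pn; exists w.
      by apply: reach_refl; rewrite setU11.
    (* The ball of radius i + 1 about [w] contains [w] and both balls of radius i about its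
       neighbours; the clause on unions gives its size. *)
    have := G2 _ _ i aQ bQ ab.
    set A := _ :|: _ => cA.
    have sA : w |: A \subset reach E (c |: D) (w |: Q) w i.+1.
      rewrite !subUset sub1set reach_refl ?setU11 //= reach_first //=.
      by rewrite ew; apply: reach_first.
    have wA : w \notin A.
      apply: contra wQ => wA; apply: (subsetP _ _ wA).
      by rewrite subUset !reach_sub.
    rewrite cw doubleS; apply: minnSS cA _.
    by apply: leq_trans (subset_leq_card sA); rewrite cardsU1 wA.
  (* While 2i + 1 <= |Q| the old ball is large enough. Beyond that it is all of [Q], and the ball of
     the radius before misses at most one vertex of [Q], so not both neighbours of [w]. *)
  have [le|gt] := leqP i.*2.+1 #|Q|.
    by rewrite cw; apply: minnS_le (BG y i yQ) (rm y i).
  have := BG y i yQ; rewrite (minn_idPl (ltnW gt)) => /(full_sub (reach_sub _ _ _ _ _)) fy.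
  case: i gt fy => [|i] gt fy; first by rewrite ltnNge ?(ltnW Q2) ?Q2 in gt.
  have m1 := BG y i yQ.
  have wr : w \in reach E (c |: D) (w |: Q) y i.+1.
    apply: wlast; apply: (miss_one (reach_sub _ _ _ _ _)) => //.
    by apply: minn_miss m1; rewrite -doubleS.
  apply: leq_trans (geq_minl _ _) _; apply: subset_leq_card.
  rewrite subUset sub1set wr -{1}fy reach_mono ?subsetUr //.
- have wy y i : y \in Q -> minn #|w |: Q| i.*2.+2 <=
     #|reach E (c |: D) (w |: Q) w i :|: reach E (c |: D) (w |: Q) y i|.
    move=> yQ; have sA : w |: reach E D Q y i \subset
        reach E (c |: D) (w |: Q) w i :|: reach E (c |: D) (w |: Q) y i.
      rewrite subUset sub1set inE reach_refl ?setU11 //=.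
      by apply: subset_trans (subsetUr _ _); apply: reach_mono; apply: subsetUr.
    have wA : w \notin reach E D Q y i by apply: contra wQ; apply: (subsetP (reach_sub _ _ _ _ _)).
    rewrite cw; apply: minnSS (BG y i yQ) _.
    by apply: leq_trans (subset_leq_card sA); rewrite cardsU1 wA.
  move=> y z i /setU1P[->|yQ] /setU1P[->|zQ]; rewrite ?eqxx //.
  + by move=> _; apply: wy.
  + by move=> _; rewrite (setUC (reach _ _ _ _ _)); apply: wy.
  move=> yz.
  have sU : reach E D Q y i :|: reach E D Q z i \subset
     reach E (c |: D) (w |: Q) y i :|: reach E (c |: D) (w |: Q) z i.
    by apply: setUSS; apply: reach_mono; apply: subsetUr.
  have [le|gt] := leqP i.*2.+2 #|Q|.
    by rewrite cw; apply: minnS_le (G2 y z i yQ zQ yz) (subset_leq_card sU).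
  have := G2 y z i yQ zQ yz; rewrite (minn_idPl (ltnW gt)) => /full_sub fy.
  have {}fy := fy _; rewrite subUset !reach_sub in fy; have {}fy := fy isT.
  case: i gt fy sU => [|i] gt fy sU; first by rewrite ltnNge ?(ltnW Q2) ?Q2 in gt.
  have m1 := G2 y z i yQ zQ yz.
  have wr : w \in reach E (c |: D) (w |: Q) y i.+1 :|: reach E (c |: D) (w |: Q) z i.+1.
    have: tgt E s1 \in reach E D Q y i :|: reach E D Q z i \/
          tgt E s2 \in reach E D Q y i :|: reach E D Q z i.
      apply: (@miss_one _ Q) => //; first by rewrite subUset !reach_sub.
      by apply: minn_miss m1; rewrite -doubleS.
    case=> /setUP[] h; apply/setUP; [left|right|left|right]; apply: wlast;
      by [left|right].
  apply: leq_trans (geq_minl _ _) _; apply: subset_leq_card.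
  by rewrite subUset sub1set wr -{1}fy.
Qed.

End Cluster.

(** * The induction step with a parallel colour, for odd order, and by bundling *)

Section Bound.
Variables T C : finType.
Implicit Types (E : C -> bool -> T * T) (K D : {set C}) (x y z : T) (X Q : {set T}).

Lemma same_endsP E c b c' b' : reflect
  (exists o, src E (c, b, false) = src E (c', b', o) /\
             tgt E (c, b, false) = tgt E (c', b', o))
  (same_ends (E c b) (E c' b')).
Proof.
rewrite /same_ends /src /tgt /=; case: (E c b) (E c' b') => [a1 a2] [b1 b2] /=.
apply: (iffP orP) => [[/eqP[-> ->]|/eqP[-> ->]]|[[] [-> ->]]].
- by exists false.
- by exists true.
- by right.
- by left.
Qed.

Lemma contract_eq Q q0 x y : q0 \in Q -> contract Q q0 x = contract Q q0 y ->
  x = y \/ (x \in Q /\ y \in Q).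
Proof.
move=> q0Q; rewrite /contract; case: ifP => xQ; case: ifP => yQ; try by auto.
- by move=> e; rewrite -e q0Q in yQ.
- by move=> e; rewrite e q0Q in xQ.
Qed.

Definition girth_bound m := forall E K X, #|X| = m -> #|K| = m -> 0 < m ->
  edges_in E K X -> rcyc E K (m + num_parallel E K).+1.

(** A ball of radius |Q|/2, rounded down, already has min(|Q|, 2 * (|Q|/2) + 1) = |Q| vertices. *)
Lemma cluster_connected E X K c0 Q D a b : cluster E X K c0 Q D -> a \in Q -> b \in Q ->
  exists l, [/\ walk E a l b, rainbow D l & size l <= #|Q|./2].
Proof.
move=> [_ _ BG _] aQ bQ; have := BG a #|Q|./2 aQ.
have le : #|Q| <= (#|Q|./2).*2.+1 by rewrite -{1}(odd_double_half #|Q|) addnC -addn1 leq_add2l leq_b1.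
rewrite (minn_idPl le) => /(full_sub (reach_sub _ _ _ _ _)) fQ.
by move: bQ; rewrite -{1}fQ => /reachP[].
Qed.

Lemma max_cluster E X K c0 Q D : cluster E X K c0 Q D -> exists Q' D',
  cluster E X K c0 Q' D' /\
  forall Q'' D'', cluster E X K c0 Q'' D'' -> #|Q''| <= #|Q'|.
Proof.
move=> cl; pose P q := `[< exists Q D, cluster E X K c0 Q D /\ #|Q| = q >].
have exP : exists q, P q by exists #|Q|; apply/asboolP; exists Q, D.
have bP q : P q -> q <= #|T| by move=> /asboolP [Q1 [D1 [_ <-]]]; apply: max_card.
case: (ex_maxnP exP bP) => q /asboolP [Q' [D' [cl' eq']]] mx.
exists Q', D'; split=> // Q'' D'' cl''; rewrite eq'; apply: mx; apply/asboolP.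
by exists Q'', D''.
Qed.

Lemma loop_arith s q m p : s <= q./2 -> q <= m -> 0 < p -> s.+1.*2 <= (m + p).+1.
Proof. by lia. Qed.

Lemma contract_arith n q m p p' : p < p' -> n + q = m.+1 ->
  (n + p).+1 + (q./2).*2 <= (m + p').+1.
Proof. by lia. Qed.

Lemma bound_parallel m E K X c0 : (forall m', m' < m -> girth_bound m') ->
  #|X| = m -> #|K| = m -> edges_in E K X -> c0 \in K -> parallel E c0 ->
  rcyc E K (m + num_parallel E K).+1.
Proof.
move=> IH cX cK hE c0K pc0.
have np0 : c0 \in [set c in K | parallel E c] by rewrite inE c0K.
have np1 : 0 < num_parallel E K by rewrite card_gt0; apply/set0Pn; exists c0.
have m0 : 0 < m by rewrite -cK card_gt0; apply/set0Pn; exists c0.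
have [e|ne] := eqVneq (E c0 false).1 (E c0 false).2.
  apply: rcyc_mono (subxx _) _ (@rcyc1 _ _ E K (c0, false, false) c0K e).
  by rewrite ltnS (leq_trans m0) // leq_addr.
have [Q [D [cl mx]]] := max_cluster (cluster_edge hE c0K ne).
have [[QX DK c0D cQ] npD _ _] := cl.
have qm : #|Q| <= m by rewrite -cX; apply: subset_leq_card.
have D0 : 0 < #|D| by rewrite card_gt0; apply/set0Pn; exists c0.
(* An edge with both ends in [Q] and colour outside [D] closes up through the cluster at length
   |Q|/2 + 1 at most. Its double is at most m + 2, which is affordable since p >= 1. *)
have [/existsP [c /existsP [b /and3P[cKD s1 s2]]]|] :=
    boolP [exists c, exists b, [&& c \in K :\: D, (E c b).1 \in Q & (E c b).2 \in Q]].
  have [l [wl rl sl]] := cluster_connected cl s2 s1.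
  exists (E c b).1, ((c, b, false) :: l); split=> //.
  - by rewrite /= /src /tgt /= eqxx.
  - rewrite -cat1s; apply: (@rainbow_sub _ ([set c] :|: D)).
      by rewrite subUset DK sub1set andbT; move: cKD; rewrite inE => /andP[].
    apply: rainbow_cat rl; last by rewrite /rainbow /= inE eqxx.
    by rewrite disjoints1; move: cKD; rewrite inE => /andP[].
  - exact: loop_arith sl qm np1.
move=> nin.
have {}nin c b : c \in K :\: D -> (E c b).1 \in Q -> (E c b).2 \in Q -> False.
  move=> h1 h2 h3; case/negP: nin; apply/existsP; exists c; apply/existsP; exists b.
  by rewrite h1 h2 h3.
have [q0 q0Q] : exists q0, q0 \in Q by apply/set0Pn; rewrite -card_gt0 cQ.
set E' := contractE E Q q0; set X' := q0 |: (X :\: Q).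
have cX' : #|X'| + #|Q| = m.+1 by rewrite card_contract // cX.
have cK' : #|K :\: D| = #|X'|.
  rewrite cardsD (setIidPr DK) cK; move: cX'; rewrite cQ addnS => -[<-]; exact: addnK.
have X'm : #|X'| < m by rewrite -ltnS -cX' cQ addnS ltnS -addn1 leq_add2l.
have X'0 : 0 < #|X'| by rewrite card_gt0; apply/set0Pn; exists q0; rewrite setU11.
have hE' : edges_in E' (K :\: D) X'.
  by apply: edges_in_sub (subsetDl _ _) _; apply: contract_edges_in.
(* A newly parallel colour has either an edge inside [Q], excluded above, or two edges from one
   outside vertex to distinct vertices of [Q], and then [cluster_extend] contradicts maximality. As
   [c0] has left, p drops strictly. *)
have npE' : num_parallel E' (K :\: D) < num_parallel E K.
  rewrite /num_parallel [X in _ < X](cardsD1 c0) np0 add1n ltnS; apply: subset_leq_card.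
  apply/subsetP => c; rewrite !inE -andbA => /and3P[cD cKc /same_endsP [o [h1 h2]]].
  have -> : c != c0 by apply: contraNneq cD => ->.
  rewrite cKc /=; have cKD : c \in K :\: D by rewrite inE cD.
  move: h1 h2; rewrite !contract_src !contract_tgt => /(contract_eq q0Q) h1 /(contract_eq q0Q) h2.
  apply/negPn/negP => npc.
  have ext s1 s2 : col s1 = c -> col s2 = c -> src E s1 = src E s2 -> tgt E s1 \in Q ->
      tgt E s2 \in Q -> tgt E s1 != tgt E s2 -> False.
    move=> e1 e2 e3 t1 t2 t3.
    have sX : src E s1 \in X :\: Q.
      rewrite inE (src_in hE) ?e1 // andbT; apply/negP => sQ.
      move: (nin (col s1) s1.1.2); rewrite e1 => /(_ cKD).
      by move: sQ t1; rewrite /src /tgt /col in e1 *; case: s1.2; rewrite e1; auto.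
    have := mx _ _ (cluster_extend cl cKc cD npc e1 e2 e3 sX t1 t2 t3).
    by rewrite cardsU1; move: sX; rewrite inE => /andP[-> _]; rewrite add1n ltnn.
  case: h1 h2 => [h1|[h1 h1']] [h2|[h2 h2']].
  - by case/negP: npc; apply/same_endsP; exists o.
  - apply: (ext (c, false, false) (c, true, o)) => //.
    by apply: contra npc => /eqP e; apply/same_endsP; exists o.
  - apply: (ext (flip (c, false, false)) (flip (c, true, o))); rewrite ?src_flip ?tgt_flip //.
    by apply: contra npc => /eqP e; apply/same_endsP; exists o.
  - exact: (nin c false).
have := IH _ X'm _ _ _ (erefl _) cK' X'0 hE'.
move/(rcyc_contract q0Q DK (fun a b => cluster_connected cl)).
apply: rcyc_mono (subxx _) _; exact: contract_arith npE' cX'.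
Qed.

Lemma bound_odd m E K X : (forall m', m' < m -> girth_bound m') -> odd m ->
  #|X| = m -> #|K| = m -> edges_in E K X -> num_parallel E K = 0 ->
  rcyc E K m.+1.
Proof.
move=> IH om cX cK hE np.
have [c0 c0K] : exists c0, c0 \in K by apply/set0Pn; rewrite -card_gt0 cK; case: m om {IH cX cK}.
(* Both edges of [c0] become its edge [false]. This raises p to one and the bound to m + 2, which is
   odd, so parity takes it back to m + 1. *)
pose f c b := (c, (c != c0) && b).
pose E' c b := E (f c b).1 (f c b).2.
have hE' : edges_in E' K X by move=> c b cK'; apply: hE.
have pc0 : parallel E' c0 by rewrite /parallel /E' /f eqxx /= /same_ends eqxx.
have := bound_parallel IH cX cK hE' c0K pc0.
have np1 : num_parallel E' K <= 1.
  rewrite -(cards1 c0); apply: subset_leq_card; apply/subsetP => c.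
  rewrite !inE => /andP[cKc]; apply: contraLR => ne; rewrite /parallel /E' /f ne /=.
  have: c \notin [set c in K | parallel E c] by rewrite (cards0_eq np) inE.
  by rewrite inE cKc.
move=> r; have {}r : rcyc E K m.+2.
  apply: rcyc_mono (subxx _) _ (rcyc_relabel (f := f) _ _ _ r) => //.
  by rewrite ltnS -addn1 leq_add2l.
by apply: rcyc_parity r => /=; rewrite om.
Qed.

(* Colours may be bundled: two colours with one edge each, on different pairs
   of vertices, make up one colour with two edges. *)
Lemma bound_bundle m E K X B : (forall m', m' < m -> girth_bound m') ->
  #|X| < m -> 0 < #|X| -> #|X| <= #|K| -> edges_in E K X ->
  (forall c c' b b', c \in K -> c' \in K -> c != c' -> ~~ same_ends (E c b) (E c' b')) ->
  #|X| < B -> 3 * #|X| + num_parallel E K < B + 2 * #|K| -> rcyc E K B.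
Proof.
move=> IH Xm X0; have [n] := ubnP (#|K| - #|X|); elim: n E K => // n IHn E K ltn XK hE sE XB le.
have [KX|KX] := eqVneq #|K| #|X|.
  apply: rcyc_mono (subxx _) _ (IH _ Xm E K X (erefl _) KX X0 hE).
  by move: le; rewrite KX; lia.
(* There are more colours than vertices here, so with at most one parallel colour |X| non-parallel
   ones can be chosen, and the bound |X| + 1 is at most [B]. *)
have [np1|] := leqP (num_parallel E K) 1.
  pose K0 := [set c in K | ~~ parallel E c].
  have cK0 : #|X| <= #|K0|.
    have := cardsID [set c | parallel E c] K.
    rewrite (_ : K :&: _ = [set c in K | parallel E c]); last by apply/setP => c; rewrite !inE.
    rewrite (_ : K :\: _ = K0); last by apply/setP => c; rewrite !inE andbC.
    by move: np1 KX XK; rewrite /num_parallel; move: #|K0| #|_| #|K| #|X|; lia.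
  have [K1 K1s cK1] := subset_of_card cK0.
  have K1K : K1 \subset K.
    by apply: subset_trans K1s _; apply/subsetP => c; rewrite inE => /andP[].
  have := IH _ Xm E K1 X (erefl _) cK1 X0 (edges_in_sub K1K hE).
  apply: rcyc_mono K1K _; rewrite (_ : num_parallel E K1 = 0) ?addn0 //.
  apply/eqP; rewrite cards_eq0; apply/eqP/setP => c; rewrite !inE; apply/negP => /andP[/(subsetP K1s)].
  by rewrite inE => /andP[_ /negP].
case/card_gt1P => c1 [c2] [] ; rewrite !inE => /andP[c1K p1] /andP[c2K p2] ne.
(* Colour [c1] keeps one of its two parallel edges and takes one of [c2] as its second; [c2] is
   dropped. Then |K| falls by one and p by two, which preserves 3|X| + p < B + 2|K|. *)
pose f c b := if c == c1 then (if b then c2 else c1, false) else (c, b).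
pose E' c b := E (f c b).1 (f c b).2.
have fK c b : c \in K -> (f c b).1 \in K by rewrite /f; case: ifP => //= _; case: b.
have finj c b c' b' : c \in K :\ c2 -> c' \in K :\ c2 -> (f c b).1 = (f c' b').1 -> c = c'.
  rewrite !inE /f => /andP[/eqP h1 _] /andP[/eqP h2 _].
  case: eqP => [->|n1]; case: eqP => [->|n2] //=; [case: b|case: b'] => /= e; congruence.
have cK2 : #|K| = #|K :\ c2|.+1 by rewrite (cardsD1 c2 K) c2K.
apply: (@rcyc_relabel _ _ E E' K (K :\ c2) _ f) => //.
  by move=> c b; rewrite inE => /andP[_]; apply: fK.
apply: IHn => //.
- by move: cK2 ltn XK KX; lia.
- by move: cK2 XK KX; lia.
- by move=> c b; rewrite inE => /andP[_ /fK h]; apply: hE.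
- move=> c c' b b' cK cK' nc; apply: sE.
  + by apply: fK; move: cK; rewrite inE => /andP[].
  + by apply: fK; move: cK'; rewrite inE => /andP[].
  + by apply: contra nc => /eqP e; apply/eqP; apply: finj e.
- have : num_parallel E' (K :\ c2) + 2 <= num_parallel E K.
    rewrite /num_parallel (cardsD1 c1 [set c in K | _]) inE c1K p1.
    rewrite (cardsD1 c2 (_ :\ _)) !inE eq_sym ne c2K p2 /= addnC addnA leq_add2l.
    apply: subset_leq_card; apply/subsetP => c; rewrite !inE -andbA => /and3P[-> cK].
    rewrite /parallel /E' /f; case: eqP => [_|_ pc]; last by rewrite cK.
    by rewrite /= (negbTE (sE _ _ _ _ _ _ _)).
  by move: le; rewrite cK2; move: (num_parallel _ _) (num_parallel _ _) #|_ :\ _|; lia.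
Qed.

End Bound.

(** * Two more edges than vertices *)

Section Surplus.
Variables T C : finType.
Implicit Types (e : C -> T * T) (K D : {set C}) (x y z : T) (X Q : {set T}).

Definition weight (w : C -> nat) (l : seq (step C)) := \sum_(s <- l) w (col s).

Lemma weight_le w K l : rainbow K l -> weight w l <= \sum_(c in K) w c.
Proof.
move=> /andP[u a]; rewrite /weight -(big_map col xpredT w) big_uniq //=.
rewrite [leqRHS]big_mkcond [leqLHS]big_mkcond /=; apply: leq_sum => c _.
by case: ifP => // cl; have /= -> := allP a _ cl.
Qed.

(** Ignoring the Boolean makes an ordinary multigraph an instance of the two-edge setting, where a
    rainbow walk is one that repeats no edge. *)
Definition single_edge e c (_ : bool) : T * T := e c.

(** Weights are there for the induction: suppressing a vertex of degree two merges two edges into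
    one that carries the sum. The application takes all weights one. *)
Definition light_cycle w e K := exists x l,
  [/\ walk (single_edge e) x l x, rainbow K l, l != [::] &
      (weight w l).*2 <= \sum_(c in K) w c].

Lemma light_cycle_sub w e K K' : K \subset K' -> light_cycle w e K -> light_cycle w e K'.
Proof.
move=> sK [x] [l] [h1 h2 h3 h4]; exists x, l; split=> //; first exact: rainbow_sub h2.
apply: leq_trans h4 _; rewrite [leqRHS]big_mkcond [leqLHS]big_mkcond /=.
by apply: leq_sum => c _; case: ifP => // /(subsetP sK) ->.
Qed.

Lemma two_cycles w e K K1 K2 B1 B2 : K1 \subset K -> K2 \subset K -> [disjoint K1 & K2] ->
  rcyc (single_edge e) K1 B1 -> rcyc (single_edge e) K2 B2 -> light_cycle w e K.
Proof.
move=> s1 s2 dis [x1] [l1] [w1 r1 n1 _] [x2] [l2] [w2 r2 n2 _].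
have le : weight w l1 + weight w l2 <= \sum_(c in K) w c.
  rewrite -big_cat; apply: weight_le; apply: rainbow_sub (rainbow_cat dis r1 r2).
  by rewrite subUset s1.
have [h|h] := leqP (weight w l1) (weight w l2).
  exists x1, l1; split=> //; first exact: rainbow_sub r1.
  by apply: leq_trans le; rewrite -addnn leq_add2l.
exists x2, l2; split=> //; first exact: rainbow_sub r2.
by apply: leq_trans le; rewrite -addnn leq_add2r ltnW.
Qed.

Definition at_vertex e K v := [set c in K | (v == (e c).1) || (v == (e c).2)].

Lemma at_vertexP e K v c : reflect
  (exists o, c \in K /\ src (single_edge e) (c, false, o) = v) (c \in at_vertex e K v).
Proof.
rewrite inE /src /=; apply: (iffP andP) => [[cK /orP[]/eqP ->]|[o [cK <-]]].
- by exists false.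
- by exists true.
- by rewrite cK; case: o; rewrite eqxx ?orbT.
Qed.

Lemma sum_at_vertex e K X : edges_in (single_edge e) K X ->
  (forall c, c \in K -> (e c).1 != (e c).2) ->
  \sum_(v in X) #|at_vertex e K v| = #|K|.*2.
Proof.
move=> hE nl; under eq_bigr => v _ do rewrite -sum1_card big_mkcond.
rewrite exchange_big /= -muln2 -sum1_card big_distrl /= [RHS]big_mkcond; apply: eq_bigr => c _.
under eq_bigr => v _ do rewrite inE.
case: ifP => cK /=; last by rewrite big1.
have [h1 h2] := hE c false cK.
rewrite -big_mkcondr /= sum1_card -[RHS](_ : #|[set (e c).1; (e c).2]| = 2).
  apply: eq_card => v; rewrite !inE unfold_in /=; case: eqP => [->|_]; first by rewrite h1.
  by case: eqP => [->|]; rewrite ?andbF // h2.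
by rewrite cards2 nl.
Qed.

(** * Suppressing a vertex of degree two *)

Section Suppress.
Variables (e : C -> T * T) (c1 c2 : C) (o1 o2 : bool).
Let E := single_edge e.
Let s1 : step C := (c1, false, o1).
Let s2 : step C := (c2, false, o2).
Hypotheses (ne : c1 != c2) (es : src E s1 = src E s2).

Definition suppress c := if c == c1 then (tgt E s1, tgt E s2) else e c.
Definition unsuppress (s : step C) :=
  if col s == c1 then (if s.2 then [:: flip s2; s1] else [:: flip s1; s2]) else [:: s].

Lemma unsuppress_walk x l y : walk (single_edge suppress) x l y ->
  walk E x (flatten (map unsuppress l)) y.
Proof.
elim: l x => //= s l IH x /andP[/eqP sx /IH w]; apply: walk_cat w.
move: sx; rewrite /unsuppress /src /tgt /single_edge /suppress -/(col s); case: eqP => [ec|_] <-.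
  by case: s.2 => /=; rewrite !src_flip !tgt_flip ?es -?es !eqxx.
by case: s => [[c b] o]; rewrite /= /src /tgt /= !eqxx.
Qed.

Lemma unsuppress_rainbow K l : c1 \in K -> c2 \in K ->
  rainbow (K :\ c2) l -> rainbow K (flatten (map unsuppress l)).
Proof.
move=> c1K c2K r.
(* The second clause is the induction invariant: [c2] occurs in the expanded walk only where [c1]
   occurs, hence at most once. *)
suff [] : rainbow K (flatten (map unsuppress l)) /\
   forall c, c \in map col (flatten (map unsuppress l)) ->
     c \in map col l \/ (c = c2 /\ c1 \in map col l) by [].
elim: l r => //= s l IH /andP[/= /andP[sn u] /andP[sK a]].
have [|r' h'] := IH; first by rewrite /rainbow u a.
have c2l : c2 \notin map col l by apply/negP => /(allP a); rewrite /= !inE eqxx.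
have [sc2 sK'] : col s != c2 /\ col s \in K by move: sK; rewrite !inE => /andP[].
have hn c : c \notin map col l -> c != c2 -> c \notin map col (flatten (map unsuppress l)).
  by move=> h1 h2; apply/negP => /h' [h|[h _]]; [rewrite h in h1 | rewrite h eqxx in h2].
rewrite /unsuppress; case: eqP => [ec|nc].
  have n1 : c1 \notin map col (flatten (map unsuppress l)) by apply: hn => //; rewrite -ec.
  have n2 : c2 \notin map col (flatten (map unsuppress l)).
    by apply/negP => /h' [h|[_ h]]; [rewrite h in c2l | rewrite -ec (negbTE sn) in h].
  move: r' => /andP[u' a']; split.
    by case: s.2; rewrite /rainbow /= /flip /col /= !inE negb_or ?ne 1?eq_sym ?ne n1 n2 u' a' c1K c2K.
  move=> c; rewrite map_cat mem_cat => /orP[|/h' [h|[h1 h2]]].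
  - by case: s.2; rewrite /= !inE => /orP[]/eqP ->; rewrite ec eqxx; auto.
  - by left; rewrite inE h orbT.
  - by right; rewrite inE h2 orbT.
move: r' => /andP[u' a']; split.
  by rewrite /rainbow /= u' a' hn // sK'.
move=> c; rewrite /= inE => /orP[/eqP ->|/h' [h|[h1 h2]]].
- by left; rewrite inE eqxx.
- by left; rewrite inE h orbT.
- by right; rewrite inE h2 orbT.
Qed.

Lemma unsuppress_weight w l :
  weight w (flatten (map unsuppress l)) =
  weight (fun c => if c == c1 then w c1 + w c2 else w c) l.
Proof.
rewrite /weight; elim: l => [|s l IH]; rewrite /= ?big_nil // big_cat big_cons /= IH.
congr (_ + _); rewrite /unsuppress; case: eqP => [ec|_]; last by rewrite big_seq1.
by case: s.2; rewrite big_cons big_seq1 /= // addnC.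
Qed.

Lemma suppress_light w K : c1 \in K -> c2 \in K ->
  light_cycle (fun c => if c == c1 then w c1 + w c2 else w c) suppress (K :\ c2) ->
  light_cycle w e K.
Proof.
move=> c1K c2K [x] [l] [wl r n le]; exists x, (flatten (map unsuppress l)); split.
- exact: unsuppress_walk.
- exact: unsuppress_rainbow.
- case: l n {wl r le} => //= s l _; rewrite /unsuppress.
  by case: (col s == c1) => //; case: (s.2).
- rewrite unsuppress_weight; apply: leq_trans le _.
  rewrite (big_setD1 c2 c2K) /=.
  have c1K' : c1 \in K :\ c2 by rewrite !inE ne.
  rewrite !(big_setD1 c1 c1K') /= eqxx addnCA addnA leq_add2l.
  by apply: leq_sum => c; rewrite !inE => /andP[/negbTE ->].
Qed.

End Suppress.

(** Loops and parallel edges give two disjoint cycles, of which the lighter one serves; vertices of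
    degree at most two are deleted or suppressed. What remains is simple of minimum degree three, so
    3n <= 2(n + 2) gives n <= 4, and the graph is complete on four vertices. *)
Lemma surplus_two w e K X : edges_in (single_edge e) K X -> 0 < #|X| ->
  #|X| + 2 <= #|K| -> light_cycle w e K.
Proof.
have [n] := ubnP #|X|; elim: n w e K X => // n IH w e K0 X ltn hE0 X0 /subset_of_card [K KK0 cK].
apply: (light_cycle_sub KK0).
have hE := edges_in_sub KK0 hE0 => {K0 KK0 hE0}.
(* Setting aside a cycle on at most two edges leaves at least |X| edges, which contain a second,
   disjoint cycle. *)
have small K1 B : K1 \subset K -> #|K1| <= 2 -> rcyc (single_edge e) K1 B -> light_cycle w e K.
  move=> s1 c1 r1; have cD := cardsD K K1; rewrite (setIidPr s1) in cD.
  have [] := @basic_cycle _ _ (single_edge e) (K :\: K1) X (edges_in_sub (subsetDl _ _) hE) X0.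
    by rewrite cD cK -addnBA // leq_addr.
  move=> B2; apply: two_cycles s1 (subsetDl _ _) _ r1.
  by rewrite disjoint_sym disjoints_subset; apply/subsetP => c; rewrite !inE => /andP[].
have [/exists_inP [c cKc /eqP lc]|] := boolP [exists c in K, (e c).1 == (e c).2].
  apply: (small [set c] 2); rewrite ?sub1set ?cards1 //.
  by apply: (@rcyc1 _ _ _ _ (c, false, false)); rewrite ?inE.
move=> /exists_inPn nl.
have [/exists_inP [c cKc /exists_inP [c' cKc' /andP[cc' /(@same_endsP _ _ (single_edge e) c false c' false) [o [h1 h2]]]]]|] :=
  boolP [exists c in K, exists c' in K, (c != c') && same_ends (e c) (e c')].
  apply: (small [set c; c'] 4).
  - by apply/subsetP => d; rewrite !inE => /orP[]/eqP ->.
  - by rewrite cards2; case: (_ != _).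
  - apply: (@rcyc2 _ _ (single_edge e) _ (c, false, false) (flip (c', false, o))); rewrite ?inE ?eqxx ?orbT //.
    + by rewrite src_flip.
    + by rewrite tgt_flip.
move=> /exists_inPn np.
have {}np c c' o o' : c \in K -> c' \in K -> src (single_edge e) (c, false, o) = src (single_edge e) (c', false, o') ->
    tgt (single_edge e) (c, false, o) = tgt (single_edge e) (c', false, o') -> c = c'.
  move=> h1 h2 h3 h4; apply/eqP; apply/negPn/negP => cc'.
  have /exists_inPn /(_ c' h2) := np c h1; rewrite cc' /= => /negP; apply.
  apply/(@same_endsP _ _ (single_edge e) c false c' false); move: h3 h4; case: o => h3 h4.
    by exists (~~ o'); rewrite -[(c', false, ~~ o')]/(flip (c', false, o')) src_flip tgt_flip -h3 -h4.
  by exists o'.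
have nls c o : c \in K -> src (single_edge e) (c, false, o) != tgt (single_edge e) (c, false, o).
  by move=> cKc; have := nl c cKc; rewrite /src /tgt /=; case: o => //; rewrite eq_sym.
have rest v c : v \in X -> c \in K -> c \notin at_vertex e K v ->
    (e c).1 \in X :\ v /\ (e c).2 \in X :\ v.
  move=> vX cKc; rewrite !inE cKc /= negb_or => /andP[h1 h2].
  by have [h3 h4] := hE c false cKc; rewrite !(eq_sym _ v) h1 h2.
have cXv v : v \in X -> #|X| = #|X :\ v|.+1 by move=> vX; rewrite (cardsD1 v X) vX.
have Xv0 v : v \in X -> 0 < #|X :\ v|.
  move=> vX; have [c cKc] : exists c, c \in K by apply/set0Pn; rewrite -card_gt0 cK addn2.
  rewrite card_gt0; apply/set0Pn; have := nl c cKc; have [h1 h2] := hE c false cKc.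
  have [->|h] := eqVneq (e c).1 v => h'; last by exists (e c).1; rewrite !inE h h1.
  by exists (e c).2; rewrite !inE eq_sym h' h2.
have [/exists_inP [v vX dv]|] := boolP [exists v in X, #|at_vertex e K v| <= 1].
  have sA : at_vertex e K v \subset K by apply/subsetP => c; rewrite inE => /andP[].
  apply: light_cycle_sub (subsetDl K (at_vertex e K v)) _; apply: (IH _ _ _ (X :\ v)).
  - by move: ltn; rewrite (cXv v vX).
  - by move=> c b; rewrite inE => /andP[h1 h2]; apply: rest.
  - exact: Xv0.
  - rewrite (cardsD K) (setIidPr sA) cK (cXv v vX).
    by move: dv; move: #|at_vertex e K v| #|X :\ v|; clear; lia.
move=> /exists_inPn d2.
have [/exists_inP [v vX /cards2P [c1 [c2 [ne eA]]]]|] := boolP [exists v in X, #|at_vertex e K v| == 2].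
  have /at_vertexP [o1 [c1K so1]] : c1 \in at_vertex e K v by rewrite eA !inE eqxx.
  have /at_vertexP [o2 [c2K so2]] : c2 \in at_vertex e K v by rewrite eA !inE eqxx orbT.
  apply: (@suppress_light e c1 c2 o1 o2) => //; first by rewrite so1.
  apply: (IH _ _ _ (X :\ v)).
  - by move: ltn; rewrite (cXv v vX).
  - have tv k o : k \in K -> src (single_edge e) (k, false, o) = v ->
        tgt (single_edge e) (k, false, o) \in X :\ v.
      by move=> kK sv; rewrite !inE (tgt_in hE) // andbT -sv eq_sym nls.
    move=> c b /setD1P [cc2 cKc]; rewrite [single_edge _ c b]/single_edge /suppress.
    case: eqP => [_|cc1]; first by split; apply: tv.
    by apply: rest => //; rewrite eA !inE negb_or cc2 andbT; apply/eqP.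
  - exact: Xv0.
  - by have := cardsD1 c2 K; rewrite c2K cK (cXv v vX) addn2 add1n => -[<-]; rewrite addn2.
move=> /exists_inPn d3.
have {}d3 v : v \in X -> 2 < #|at_vertex e K v|.
  by move=> vX; have := d2 v vX; rewrite -ltnNge => h; rewrite ltn_neqAle h eq_sym d3.
pose other v c := if (e c).1 == v then (e c).2 else (e c).1.
have otherP v c : c \in at_vertex e K v -> exists o, [/\ c \in K, src (single_edge e) (c, false, o) = v &
    tgt (single_edge e) (c, false, o) = other v c].
  case/at_vertexP => o [cKc so]; exists o; split=> //; move: so (nls c o cKc).
  rewrite /other /src /tgt /=; case: o => <-; last by rewrite eqxx.
  by move=> h; rewrite eq_sym (negbTE h).
have oinj v : {in at_vertex e K v &, injective (other v)}.
  move=> c c' /otherP [o [h1 h2 h3]] /otherP [o' [h1' h2' h3']] eo.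
  by apply: (np c c' o o') => //; rewrite ?h2 ?h3 ?h2' ?h3'.
have osub v : v \in X -> other v @: at_vertex e K v \subset X :\ v.
  move=> vX; apply/subsetP => _ /imsetP [c /otherP [o [h1 h2 h3]] ->].
  by rewrite -h3 !inE (tgt_in hE) // andbT -h2 eq_sym nls.
have X4 : #|X| = 4.
  have := sum_at_vertex hE nl; rewrite cK => sm.
  have : \sum_(v in X) 3 <= (#|X| + 2).*2 by rewrite -sm; apply: leq_sum => v /d3.
  rewrite sum_nat_const => le.
  have [v vX] : exists v, v \in X by apply/set0Pn; rewrite -card_gt0.
  have := subset_leq_card (osub v vX); rewrite card_in_imset ?(cXv v vX); last exact: oinj.
  have := d3 v vX; move: le; rewrite (cXv v vX).
  by move: #|at_vertex e K v| #|X :\ v|; clear; lia.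
have adj u v : u \in X -> v \in X -> u != v -> exists c o, [/\ c \in K, src (single_edge e) (c, false, o) = u &
    tgt (single_edge e) (c, false, o) = v].
  move=> uX vX uv; have : v \in other u @: at_vertex e K u.
    rewrite (full_sub (osub u uX)) ?inE ?(eq_sym v) ?uv //.
    rewrite card_in_imset; last exact: oinj.
    by have := cXv u uX; rewrite X4 => -[<-]; apply: d3.
  by case/imsetP => c /otherP [o [h1 h2 h3]] ->; exists c, o.
have [a [b [c [d [[aX bX cX dX] u4]]]]] : exists a b c d, [/\ a \in X, b \in X, c \in X & d \in X] /\
   uniq [:: a; b; c; d].
  have := enum_uniq (mem X); have := cardE X; rewrite X4.
  have := mem_enum (mem X); case: (enum _) => [|a [|b [|c [|d [|? ?]]]]] // me _ u.
  by exists a, b, c, d; split=> //; split; rewrite -[_ \in X]me !inE eqxx ?orbT.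
move: u4; rewrite /= !inE !negb_or !andbA andbT => /andP[/andP[/andP[/andP[/andP[ab ac] ad] bc] bd] cd].
have [k1 [o1 [K1 p1 q1]]] := adj a b aX bX ab.
have [k2 [o2 [K2 p2 q2]]] := adj a c aX cX ac.
have [k3 [o3 [K3 p3 q3]]] := adj a d aX dX ad.
have [k4 [o4 [K4 p4 q4]]] := adj b c bX cX bc.
have [k5 [o5 [K5 p5 q5]]] := adj b d bX dX bd.
have [k6 [o6 [K6 p6 q6]]] := adj c d cX dX cd.
have dif k o k' o' : src (single_edge e) (k, false, o) != src (single_edge e) (k', false, o') ->
    src (single_edge e) (k, false, o) != tgt (single_edge e) (k', false, o') -> k != k'.
  by rewrite /src /tgt /=; move=> h1 h2; apply: contraTneq h1 => ek; move: h2; rewrite ek;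
     case: o; case: o'; rewrite ?eqxx.
have dif' k o k' o' : tgt (single_edge e) (k, false, o) != src (single_edge e) (k', false, o') ->
    tgt (single_edge e) (k, false, o) != tgt (single_edge e) (k', false, o') -> k != k'.
  by rewrite /src /tgt /=; move=> h1 h2; apply: contraTneq h1 => ek; move: h2; rewrite ek;
     case: o; case: o'; rewrite ?eqxx.
have n12 : k1 != k2 by apply: (dif' _ o1 _ o2); rewrite q1 ?p2 ?q2 // eq_sym.
have n13 : k1 != k3 by apply: (dif' _ o1 _ o3); rewrite q1 ?p3 ?q3 // eq_sym.
have n14 : k1 != k4 by apply: (dif _ o1 _ o4); rewrite p1 ?p4 ?q4.
have n15 : k1 != k5 by apply: (dif _ o1 _ o5); rewrite p1 ?p5 ?q5.
have n16 : k1 != k6 by apply: (dif _ o1 _ o6); rewrite p1 ?p6 ?q6.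
have n23 : k2 != k3 by apply: (dif' _ o2 _ o3); rewrite q2 ?p3 ?q3 // eq_sym.
have n24 : k2 != k4 by apply: (dif _ o2 _ o4); rewrite p2 ?p4 ?q4.
have n25 : k2 != k5 by apply: (dif _ o2 _ o5); rewrite p2 ?p5 ?q5.
have n26 : k2 != k6 by apply: (dif _ o2 _ o6); rewrite p2 ?p6 ?q6.
have n34 : k3 != k4 by apply: (dif _ o3 _ o4); rewrite p3 ?p4 ?q4.
have n35 : k3 != k5 by apply: (dif _ o3 _ o5); rewrite p3 ?p5 ?q5.
have n36 : k3 != k6 by apply: (dif _ o3 _ o6); rewrite p3 ?p6 ?q6.
have n45 : k4 != k5 by apply: (dif' _ o4 _ o5); rewrite q4 ?p5 ?q5 // eq_sym.
have n46 : k4 != k6 by apply: (dif _ o4 _ o6); rewrite p4 ?p6 ?q6.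
have n56 : k5 != k6 by apply: (dif _ o5 _ o6); rewrite p5 ?p6 ?q6.
have r6 : rainbow K [:: (k1, false, o1); (k2, false, o2); (k3, false, o3);
                        (k4, false, o4); (k5, false, o5); (k6, false, o6)].
  by rewrite /rainbow /= /col /= !inE !negb_or K1 K2 K3 K4 K5 K6 n12 n13 n14 n15 n16
       n23 n24 n25 n26 n34 n35 n36 n45 n46 n56.
have := weight_le w r6; rewrite /weight !big_cons big_nil /col /= addn0 => le6.
have tri s1 s2 s3 : rainbow K [:: s1; s2; s3] -> tgt (single_edge e) s1 = src (single_edge e) s2 -> tgt (single_edge e) s2 = tgt (single_edge e) s3 ->
   src (single_edge e) s1 = src (single_edge e) s3 -> (w (col s1) + w (col s2) + w (col s3)).*2 <= \sum_(c in K) w c ->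
   light_cycle w e K.
  move=> r h1 h2 h3 h4; exists (src (single_edge e) s1), [:: s1; s2; flip s3]; split=> //.
  - by rewrite /= -/(single_edge e) src_flip tgt_flip h1 h2 h3 !eqxx.
  - by rewrite /weight !big_cons big_nil /= addn0 addnA.
(* The four triangles cover each of the six edges exactly twice, so they cannot all weigh more than
   half of the total. *)
have [t1|t1] := leqP (w k1 + w k4 + w k2).*2 (\sum_(c in K) w c).
  apply: (tri (k1, false, o1) (k4, false, o4) (k2, false, o2)); rewrite ?p1 ?q1 ?p2 ?q2 ?p4 ?q4 //.
  by rewrite /rainbow /= /col /= !inE !negb_or K1 K2 K4 n12 n14 eq_sym n24.
have [t2|t2] := leqP (w k1 + w k5 + w k3).*2 (\sum_(c in K) w c).
  apply: (tri (k1, false, o1) (k5, false, o5) (k3, false, o3)); rewrite ?p1 ?q1 ?p3 ?q3 ?p5 ?q5 //.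
  by rewrite /rainbow /= /col /= !inE !negb_or K1 K3 K5 n13 n15 eq_sym n35.
have [t3|t3] := leqP (w k2 + w k6 + w k3).*2 (\sum_(c in K) w c).
  apply: (tri (k2, false, o2) (k6, false, o6) (k3, false, o3)); rewrite ?p2 ?q2 ?p3 ?q3 ?p6 ?q6 //.
  by rewrite /rainbow /= /col /= !inE !negb_or K2 K3 K6 n23 n26 eq_sym n36.
have [t4|t4] := leqP (w k4 + w k6 + w k5).*2 (\sum_(c in K) w c).
  apply: (tri (k4, false, o4) (k6, false, o6) (k5, false, o5)); rewrite ?p4 ?q4 ?p5 ?q5 ?p6 ?q6 //.
  by rewrite /rainbow /= /col /= !inE !negb_or K4 K5 K6 n45 n46 eq_sym n56.
exfalso; move: le6 t1 t2 t3 t4.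
by move: (w k1) (w k2) (w k3) (w k4) (w k5) (w k6) (\sum_(c in K) _); clear; lia.
Qed.

End Surplus.

Lemma sum_bool_card (A : finType) (B : {set A}) (P : pred A) :
  \sum_(c in B) (P c : nat) = #|[set c in B | P c]|.
Proof.
rewrite -sum1_card [RHS]big_mkcond [LHS]big_mkcond /=; apply: eq_bigr => c _.
by rewrite inE; case: (c \in B); case: (P c).
Qed.

Lemma sum_pairs_card (A : finType) (B : {set A}) (P : A -> bool -> bool) :
  \sum_(c in B) (P c false + P c true) = #|[set e : A * bool | (e.1 \in B) && P e.1 e.2]|.
Proof.
have -> : \sum_(c in B) (P c false + P c true) = \sum_(c in B) \sum_(b : bool) (P c b : nat).
  by apply: eq_bigr => c _; rewrite big_bool addnC.
rewrite pair_big /= -sum1_card [RHS]big_mkcond [LHS]big_mkcond /=; apply: eq_bigr => -[c b] _ /=.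
by rewrite inE andbT /=; case: (c \in B); case: (P c b).
Qed.

(** * The even case without parallel colours *)

Section Incidence.
Variables T C : finType.
Variables (E : C -> bool -> T * T) (X : {set T}) (K : {set C}).
Implicit Types (c : C) (b : bool) (v w : T) (S : {set T}).

Definition incident v c b := (v == (E c b).1) || (v == (E c b).2).
Definition touched S c b := ((E c b).1 \in S) || ((E c b).2 \in S).
Definition dead_colour S c := touched S c false && touched S c true.

(** This and the following counts are sums over colours, so that the identities between them reduce
    to a Boolean case check for a single colour. *)
Definition touch_rank S := \sum_(c in K) (touched S c false + touched S c true).
Definition num_dead S := \sum_(c in K) (dead_colour S c : nat).
(** For [w] outside [S] these are the edges between [w] and [S]; for [w] in [S] every edge at [w]
    counts. *)
Definition num_links S w := \sum_(c in K) (incident w c false && touched S c false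
                                       + (incident w c true && touched S c true)).
Definition num_fresh S w := \sum_(c in K) (dead_colour (w |: S) c && ~~ dead_colour S c : nat).
Definition num_half S := \sum_(c in K) (touched S c false (+) touched S c true : nat).

Lemma touchesU1 w S c b : touched (w |: S) c b = incident w c b || touched S c b.
Proof.
rewrite /touched /incident !inE !(eq_sym w).
by case: (_ == w); case: (_ == w); case: (_ \in S).
Qed.

Lemma touches1 v c b : touched [set v] c b = incident v c b.
Proof. by rewrite /touched /incident !inE !(eq_sym v). Qed.

Lemma touchesP S c b : reflect (exists2 v, v \in S & incident v c b) (touched S c b).
Proof.
apply: (iffP orP) => [[] h|[v vS /orP[] /eqP e]].
- by exists (E c b).1; rewrite // /incident eqxx.
- by exists (E c b).2; rewrite // /incident eqxx orbT.
- by left; rewrite -e.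
- by right; rewrite -e.
Qed.

Lemma rankE S : touch_rank S = (num_dead S).*2 + num_half S.
Proof.
rewrite -addnn -!big_split; apply: eq_bigr => c _ /=.
by rewrite /dead_colour; case: (touched S c false); case: (touched S c true).
Qed.

Lemma rankU1 S w : touch_rank (w |: S) + num_links S w = touch_rank S + touch_rank [set w].
Proof.
rewrite -!big_split; apply: eq_bigr => c _ /=; rewrite !touchesU1 !touches1.
by case: (incident w c false); case: (incident w c true);
   case: (touched S c false); case: (touched S c true).
Qed.

Lemma ndeadU1 S w : num_dead (w |: S) = num_dead S + num_fresh S w.
Proof.
rewrite -big_split; apply: eq_bigr => c _ /=; rewrite /dead_colour !touchesU1.
by case: (incident w c false); case: (incident w c true);
   case: (touched S c false); case: (touched S c true).
Qed.

Lemma card_dead S : num_dead S + #|[set c in K | ~~ dead_colour S c]| = #|K|.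
Proof.
rewrite /num_dead sum_bool_card -(cardsID [set c | dead_colour S c] K); congr (_ + _).
  by apply: eq_card => c; rewrite !inE.
by apply: eq_card => c; rewrite !inE andbC.
Qed.

End Incidence.

Section EvenCase.
Variables T C : finType.
Variables (E : C -> bool -> T * T) (X : {set T}) (K : {set C}) (m : nat).
Hypotheses (IH : forall m', m' < m -> girth_bound T C m') (em : ~~ odd m) (m0 : 0 < m)
  (cX : #|X| = m) (cK : #|K| = m) (hE : edges_in E K X) (np : num_parallel E K = 0)
  (noC : ~ rcyc E K m.+1).
Implicit Types (c : C) (b : bool) (v w : T) (S : {set T}).

Local Notation inc := (incident E).
Local Notation touches := (touched E).
Local Notation dead := (dead_colour E).
Local Notation rank := (touch_rank E K).
Local Notation ndead := (num_dead E K).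
Local Notation links := (num_links E K).
Local Notation fresh := (num_fresh E K).
Local Notation nhalf := (num_half E K).

Lemma not_parallel c : c \in K -> ~~ parallel E c.
Proof.
move=> cKc; have: c \notin [set c in K | parallel E c] by rewrite (cards0_eq np) inE.
by rewrite inE cKc.
Qed.

Lemma m_ge2 : 1 < m.
Proof. by move: em m0; case: m => [|[]]. Qed.

Lemma no_loop c b : c \in K -> (E c b).1 != (E c b).2.
Proof.
move=> cKc; apply/eqP => e; apply: noC.
apply: rcyc_mono (subxx _) _ (@rcyc1 _ _ E K (c, b, false) cKc e).
by rewrite ltnS ltnW // m_ge2.
Qed.

Lemma inc_in v c b : c \in K -> inc v c b -> v \in X.
Proof. by move=> /(hE b) [h1 h2] /orP[] /eqP ->. Qed.

Lemma card_inc c b : c \in K -> #|[set v in X | inc v c b]| = 2.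
Proof.
move=> cKc; rewrite -[RHS](_ : #|[set (E c b).1; (E c b).2]| = 2); last by rewrite cards2 no_loop.
apply: eq_card => v; rewrite !inE; apply/andP/idP => [[]|h] //; split=> //.
exact: (@inc_in v c b).
Qed.

Lemma same_ends_inc c b c' b' v w : v != w -> inc v c b -> inc w c b ->
  inc v c' b' -> inc w c' b' -> same_ends (E c b) (E c' b').
Proof.
rewrite /same_ends /inc; case: (E c b) (E c' b') => [a1 a2] [b1 b2] /= vw.
case/orP => /eqP <-; case/orP => /eqP e1; case/orP => /eqP e2; case/orP => /eqP e3;
  subst; rewrite ?eqxx ?orbT // in vw *.
Qed.

Lemma m_gt2 : 2 < m.
Proof.
rewrite ltn_neqAle m_ge2 andbT; apply/eqP => m2.
have [c cKc] : exists c, c \in K by apply/set0Pn; rewrite -card_gt0 cK.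
have full b : [set v in X | inc v c b] = X.
  apply: full_sub; first by apply/subsetP => v; rewrite inE => /andP[].
  by rewrite card_inc // cX -m2.
have hi b v : v \in X -> inc v c b by rewrite -{1}(full b) inE => /andP[].
case/negP: (not_parallel cKc); have [h1 h2] := hE false cKc.
by apply: same_ends_inc (no_loop false cKc) _ _ _ _; apply: hi.
Qed.

Lemma simple c c' b b' : c \in K -> c' \in K -> c != c' -> ~~ same_ends (E c b) (E c' b').
Proof.
move=> h1 h2 ne; apply/negP => /same_endsP [o [e1 e2]]; apply: noC.
apply: rcyc_mono (subxx _) _ (@rcyc2 _ _ E K (c, b, false) (flip (c', b', o)) _ _ _ _ _) => //.
- by rewrite ltnS m_gt2.
- by rewrite src_flip.
- by rewrite tgt_flip.
Qed.

Lemma edge_eq c c' b b' v w : c \in K -> c' \in K -> v != w ->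
  inc v c b -> inc w c b -> inc v c' b' -> inc w c' b' -> c = c' /\ b = b'.
Proof.
move=> h1 h2 vw i1 i2 i3 i4; have se := same_ends_inc vw i1 i2 i3 i4.
have ec : c = c' by apply/eqP; apply: contraTT se => /(simple b b' h1 h2).
split=> //; subst c'; have np' := not_parallel h1; have := same_ends_inc vw i3 i4 i1 i2.
by rewrite /parallel in np'; case: b b' se {i1 i2 i3 i4} => [] [] // se h;
   rewrite ?se ?h in np'.
Qed.

Lemma touchesX c b : c \in K -> touches X c b.
Proof. by move=> /(hE b) [h1 h2]; rewrite /touched h1. Qed.

(* Delete [S] and bundle the colours that lose one edge. *)
Lemma deletion S : S \subset X -> 0 < #|S| < m -> rank S <= 3 * #|S| -> #|S| < ndead S.
Proof.
move=> SX /andP[s0 sm] rS; rewrite ltnNge; apply/negP => dS; apply: noC.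
pose K' := [set c in K | ~~ dead S c].
(* A touched edge is replaced by the other edge of its colour, which is untouched when the colour is
   alive. Hence the colours made parallel are among those with exactly one touched edge. *)
pose f c b := (c, b (+) touches S c b).
pose E' c b := E (f c b).1 (f c b).2.
have cXS : #|X :\: S| = m - #|S| by rewrite cardsD (setIidPr SX) cX.
have cK' := card_dead E K S; rewrite cK -/K' in cK'.
have K'K : K' \subset K by apply/subsetP => c; rewrite inE => /andP[].
apply: (@rcyc_mono _ _ E K' K m.+1 m.+1) => //.
apply: (@rcyc_relabel _ _ E E' K' K' _ f) => //.
apply: (bound_bundle IH (X := X :\: S)).
- by move: cXS s0 sm; clear; lia.
- by move: cXS s0 sm; clear; lia.
- by move: cXS s0 sm dS cK'; clear; lia.
- move=> c b; rewrite inE => /andP[cKc nd].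
  have [h1 h2] := hE (f c b).2 cKc; rewrite !inE h1 h2 !andbT; apply/andP.
  rewrite -negb_or -/(touches S c (f c b).2) /f /=.
  by move: nd {h1 h2}; rewrite /dead_colour; case: b; case t1: (touches S c false);
     case t2: (touches S c true); rewrite //= ?t1 ?t2.
- by move=> c c' b b' h1 h2 nc; apply: simple => //; apply: (subsetP K'K).
- by rewrite cXS; move: s0 sm; clear; lia.
- have : num_parallel E' K' <= nhalf S.
    rewrite /num_half sum_bool_card; apply: subset_leq_card; apply/subsetP => c.
    rewrite !inE -andbA => /and3P[cKc nd]; rewrite cKc /=; apply: contraLR => nx.
    have := not_parallel cKc; rewrite /parallel /E' /f; move: nd nx; rewrite /dead_colour.
    by case: (touches S c false); case: (touches S c true).
  move: rS; rewrite rankE cXS; move: cK' s0 sm dS.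
  by move: (ndead S) (nhalf S) #|K'| (num_parallel _ _) #|S|; clear; lia.
Qed.

Lemma ndeadX : ndead X = m.
Proof.
rewrite /num_dead (eq_bigr (fun=> 1)) ?sum1_card // => c cKc.
by rewrite /dead_colour !touchesX.
Qed.

(** Keep one untouched edge of every colour that is alive. If [S] killed at most |S| - 2 colours,
    the m - |S| other vertices would carry at least two more edges than there are vertices, and
    [surplus_two] would give a cycle of length at most half the number of these edges. *)
Lemma ndead_ge S : S \subset X -> #|S| <= (ndead S).+1.
Proof.
move=> SX; rewrite leqNgt; apply/negP => dS; apply: noC.
have sm : #|S| < m.
  rewrite -cX ltn_neqAle subset_leq_card // andbT; apply/negP => /eqP e.
  have eS : S = X by apply: full_sub => //; rewrite e.
  by move: dS; rewrite eS ndeadX cX; clear; lia.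
pose K' := [set c in K | ~~ dead S c].
pose f c (b : bool) := (c, touches S c false).
have cXS : #|X :\: S| = m - #|S| by rewrite cardsD (setIidPr SX) cX.
have cK' := card_dead E K S; rewrite cK -/K' in cK'.
have K'K : K' \subset K by apply/subsetP => c; rewrite inE => /andP[].
have [] := @surplus_two T C (fun=> 1) (fun c => E c (touches S c false)) K' (X :\: S).
- move=> c b; rewrite inE => /andP[cKc nd]; rewrite /single_edge.
  have [h1 h2] := hE (touches S c false) cKc; rewrite !inE h1 h2 !andbT; apply/andP.
  rewrite -negb_or -/(touches S c (touches S c false)).
  by move: nd; rewrite /dead_colour; case t1: (touches S c false); case t2: (touches S c true);
    rewrite //= ?t1 ?t2.
- by move: cXS sm; clear; lia.
- by move: cXS sm cK' dS; clear; lia.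
move=> x [l] [w r n le].
apply: (@rcyc_mono _ _ E K' K m.+1 m.+1) => //.
apply: (@rcyc_relabel _ _ E (single_edge (fun c => E c (touches S c false))) K' K' _ f) => //.
exists x, l; split=> //; move: le; rewrite /weight !sum1_size sum1_card.
by move: cK'; clear; lia.
Qed.

Lemma rank1_sum : \sum_(v in X) rank [set v] = 4 * m.
Proof.
rewrite exchange_big /= mulnC -cK -sum_nat_const; apply: eq_bigr => c cKc.
rewrite big_split /=.
under eq_bigr => v _ do rewrite touches1.
under [X in _ + X]eq_bigr => v _ do rewrite touches1.
by rewrite !sum_bool_card !card_inc.
Qed.

Lemma ndead1_le v : ndead [set v] <= (rank [set v])./2.
Proof. by rewrite rankE; move: (ndead _) (nhalf _); clear; lia. Qed.

(** At most three edges at a vertex kill at most one colour, which [deletion] forbids; so all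
    degrees are at least four, and their sum is 4m. *)
Lemma rank1 v : v \in X -> rank [set v] = 4.
Proof.
have ge v' : v' \in X -> 4 <= rank [set v'].
  move=> vX; rewrite ltnNge; apply/negP => r3.
  have := @deletion [set v']; rewrite sub1set cards1 m_ge2 /= => /(_ vX isT r3).
  by have := ndead1_le v'; move: r3; move: (rank _) (ndead _); clear; lia.
move=> vX; apply/eqP; rewrite eqn_leq ge // andbT leqNgt; apply/negP => gt.
have := rank1_sum; rewrite (big_setD1 v vX) /=.
have : \sum_(i in X :\ v) 4 <= \sum_(i in X :\ v) rank [set i].
  by apply: leq_sum => i; rewrite inE => /andP[_]; apply: ge.
rewrite sum_nat_const; have := cardsD1 v X; rewrite vX cX.
by move: gt; move: (rank _) #|_| (\sum_(i in _) _); clear; lia.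
Qed.

(** Each touched edge is counted at both of its ends, and the vertices of [S] account for all four
    edges at each of them. *)
Lemma links_sum S : S \subset X -> \sum_(w in X :\: S) links S w + 4 * #|S| = (rank S).*2.
Proof.
move=> SX; have sumX : \sum_(w in X) links S w = (rank S).*2.
  rewrite exchange_big /= -muln2 big_distrl /=; apply: eq_bigr => c cKc.
  have cnt b t : \sum_(w in X) (inc w c b && t : nat) = t * 2.
    case: t; last by rewrite big1 // => w _; rewrite andbF.
    by under eq_bigr => w _ do rewrite andbT; rewrite sum_bool_card card_inc.
  by rewrite big_split /= !cnt mulnDl.
have sumS : \sum_(w in S) links S w = 4 * #|S|.
  rewrite mulnC -sum_nat_const; apply: eq_bigr => w wS.
  rewrite -(rank1 (subsetP SX _ wS)); apply: eq_bigr => c _; rewrite !touches1.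
  have h b : inc w c b && touches S c b = inc w c b.
    by case i: (inc w c b) => //=; apply/touchesP; exists w.
  by rewrite !h.
by rewrite -sumX -sumS [RHS](big_setID S) /= (setIidPr SX) addnC.
Qed.

(** Colour by colour: a dead colour is never fresh, a half-touched one can be killed only at the two
    ends of its untouched edge, and an untouched one only at the common vertex of its edges. *)
Lemma fresh_sum S : S \subset X ->
  \sum_(w in X :\: S) fresh S w + ndead S <= m + nhalf S.
Proof.
move=> SX; rewrite exchange_big /= -{1}cK -sum1_card -!big_split; apply: leq_sum => c cKc /=.
have sub b : \sum_(w in X :\: S) (inc w c b : nat) <= 2.
  rewrite sum_bool_card -(card_inc b cKc); apply: subset_leq_card; apply/subsetP => w.
  by rewrite !inE -andbA => /and3P[_ -> ->].
under eq_bigr => w _ do rewrite /dead_colour !touchesU1.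
rewrite /dead_colour; case tf: (touches S c false); case tt: (touches S c true) => /=.
- by rewrite big1 // => w _; rewrite !orbT.
- rewrite addn0; apply: leq_trans (sub true); apply: leq_sum => w _.
  by rewrite orbT orbF andbT.
- rewrite addn0; apply: leq_trans (sub false); apply: leq_sum => w _.
  by rewrite orbT orbF !andbT.
rewrite !addn0 sum_bool_card leqNgt; apply/negP => /card_gt1P [w [w' []]].
rewrite !inE !orbF !andbT => /andP[_ /andP[h1 h2]] /andP[_ /andP[h3 h4]] ne.
by have [_] := edge_eq cKc cKc ne h1 h3 h2 h4.
Qed.

Lemma centre_uniq c v w : c \in K -> dead [set v] c -> dead [set w] c -> v = w.
Proof.
rewrite /dead_colour !touches1 => cKc /andP[h1 h2] /andP[h3 h4]; apply/eqP.
apply/negPn/negP => vw; by have [_] := edge_eq cKc cKc vw h1 h3 h2 h4.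
Qed.

Lemma inc_two c b u v w : c \in K -> u != v -> inc u c b -> inc v c b -> inc w c b ->
  w = u \/ w = v.
Proof.
rewrite /incident; case: (E c b) => [a1 a2] /= cKc uv.
by case/orP => /eqP h1; case/orP => /eqP h2; case/orP => /eqP h3; subst; auto;
   rewrite eqxx in uv.
Qed.

Lemma ndeadD1 g : ndead (X :\ g) = m.
Proof.
rewrite /num_dead (eq_bigr (fun=> 1)) ?sum1_card // => c cKc.
suff t b : touches (X :\ g) c b by rewrite /dead_colour !t.
have [h1 h2] := hE b cKc; have := no_loop b cKc; rewrite /touched !inE h1 h2 !andbT.
by have [->|//] := eqVneq (E c b).1 g; rewrite eq_sym.
Qed.

(** Colours and vertices are equally many, so taking centres is a bijection and every [S] kills at
    least |S| colours. An extremal [S] kills exactly |S| and touches 3|S| + 1 edges, so |S| + 1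
    colours are half touched. The set [P] of their centres contains both ends of |P| edges of
    distinct colours, and 2|P| <= m makes the resulting cycle short. *)
Lemma all_centres : (forall v, v \in X -> 0 < ndead [set v]) -> False.
Proof.
move=> cen; have [c0 c0K] : exists c, c \in K by apply/set0Pn; rewrite -card_gt0 cK.
pose ctr v := odflt c0 [pick c in K | dead [set v] c].
have ctrP v : v \in X -> ctr v \in K /\ dead [set v] (ctr v).
  move=> vX; rewrite /ctr; case: pickP => [c /andP[] //|h]; have := cen v vX.
  rewrite /num_dead big1 // => c cKc; by have := h c; rewrite /= cKc /= => ->.
have ctr_inj : {in X &, injective ctr}.
  move=> v w vX wX e; have [h1 h2] := ctrP v vX; have [h3 h4] := ctrP w wX.
  by apply: (centre_uniq h1) => //; rewrite e.
have ctrK : ctr @: X = K.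
  apply: full_sub; last by rewrite card_in_imset // cX cK.
  by apply/subsetP => _ /imsetP [v /ctrP [? _] ->].
have inc_ctr v b : v \in X -> inc v (ctr v) b.
  by case/ctrP => _; rewrite /dead_colour !touches1 => /andP[]; case: b.
have dead_ctr S v : S \subset X -> v \in S -> dead S (ctr v).
  move=> SX vS; have vX := subsetP SX _ vS.
  by apply/andP; split; apply/touchesP; exists v => //; apply: inc_ctr.
have ctr_set S : S \subset X -> ctr @: S \subset [set c in K | dead S c].
  move=> SX; apply/subsetP => _ /imsetP [v vS ->]; rewrite inE dead_ctr // andbT.
  by have [] := ctrP v (subsetP SX _ vS).
have ge_dead S : S \subset X -> #|S| <= ndead S.
  move=> SX; rewrite /num_dead sum_bool_card -(card_in_imset (f := ctr)).
    exact/subset_leq_card/ctr_set.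
  by move=> v w vS wS; apply: ctr_inj; apply: (subsetP SX).
have [v0 v0X] : exists v, v \in X by apply/set0Pn; rewrite -card_gt0 cX.
pose good S := [&& S \subset X, 0 < #|S| < m, rank S <= (3 * #|S|).+1 & ndead S <= #|S|].
have g0 : good [set v0].
  rewrite /good sub1set v0X cards1 m_ge2 rank1 //= /num_dead sum_bool_card -(cards1 (ctr v0)).
  apply: subset_leq_card; apply/subsetP => c; rewrite !inE => /andP[cKc dc].
  move: (cKc); rewrite -ctrK => /imsetP [v vX ec]; have [h1 h2] := ctrP v vX.
  by rewrite ec; apply/eqP; congr ctr; apply/esym/(centre_uniq cKc dc); rewrite ec.
case: (@arg_maxnP _ [set v0] good (fun S => #|S|) g0) => S /and4P[SX /andP[s0 sm] rS dS] mx.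
have {}dS : ndead S = #|S| by apply/eqP; rewrite eqn_leq dS ge_dead.
have {}rS : rank S = (3 * #|S|).+1.
  apply/eqP; rewrite eqn_leq rS ltnNge; apply/negP => le.
  by have := deletion SX; rewrite s0 sm => /(_ isT le); rewrite dS ltnn.
have hS : nhalf S = #|S|.+1 by have := rankE E K S; rewrite rS dS; move: #|S| (nhalf S); clear; lia.
have deadS : [set c in K | dead S c] = ctr @: S.
  apply/esym/full_sub; first exact: ctr_set.
  rewrite -sum_bool_card -/(ndead S) dS card_in_imset // => v w vS wS.
  by apply: ctr_inj; apply: (subsetP SX).
pose half c := touches S c false (+) touches S c true.
pose P := [set g in X | half (ctr g)].
have cP : #|P| = #|S|.+1.
  rewrite -hS /num_half sum_bool_card -(card_in_imset (f := ctr) (D := mem P)).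
    apply: eq_card => c; rewrite inE; apply/imsetP/andP => [[g]|[cKc hc]].
      by rewrite inE => /andP[gX hg] ->; split=> //; have [] := ctrP g gX.
    move: (cKc); rewrite -ctrK => /imsetP [g gX ec].
    by exists g => //; rewrite inE gX -ec.
  by move=> v w; rewrite !inE => /andP[vX _] /andP[wX _]; apply: ctr_inj.
have PX : P \subset X by apply/subsetP => g; rewrite inE => /andP[].
have PS g : g \in P -> g \notin S.
  rewrite inE => /andP[gX hg]; apply/negP => gS; have := dead_ctr S g SX gS.
  by move: hg; rewrite /half /dead_colour; case: (touches S _ false); case: (touches S _ true).
(* One edge of [ctr g] joins [g] to [S], so adding [g] touches at most three new edges, and by
   maximality it kills two colours. The one other than [ctr g] is not centred at [g]; so [S] touches
   one of its edges and [g] is an end of the other. *)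
have hit g : g \in P -> exists c b, [/\ c \in K, c != ctr g, ~~ touches S c b,
     touches S c (~~ b) & inc g c b].
  move=> gP; have gX := subsetP PX _ gP; have gS := PS g gP.
  have lk : 0 < links S g.
    have [gK _] := ctrP g gX; rewrite /num_links (big_setD1 _ gK) /= ltn_addr // !inc_ctr //=.
    by move: gP; rewrite inE gX /half /=; case: (touches S _ false); case: (touches S _ true).
  have cgS : #|g |: S| = #|S|.+1 by rewrite cardsU1 gS.
  have sm' : #|S|.+1 < m.
    rewrite ltn_neqAle sm andbT; apply/eqP => e.
    have eS : S = X :\ g.
      apply: full_sub; first by apply/subsetP => v vS; rewrite !inE (subsetP SX _ vS) andbT;
        apply: contraNneq gS => <-.
      by have := cardsD1 g X; rewrite gX cX -e add1n => -[<-].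
    by move: sm; rewrite -dS {1}eS ndeadD1 ltnn.
  have fr : 1 < fresh S g.
    rewrite ltnNge; apply/negP => fr; have : good (g |: S).
      have nd : ndead (g |: S) <= #|S|.+1 by rewrite ndeadU1 dS -addn1 leq_add2l.
      rewrite /good subUset sub1set gX SX cgS sm' nd andbT /=.
      have := rankU1 E K S g; rewrite rS rank1 //; move: lk.
      by move: (links S g) (rank (g |: S)) #|S|; clear; lia.
    by move/mx => /=; rewrite cgS ltnn.
  move: fr; rewrite /num_fresh sum_bool_card => fr.
  have [c] : exists c, c \in [set c in K | dead (g |: S) c && ~~ dead S c] :\ ctr g.
    apply/set0Pn; rewrite -card_gt0; have := cardsD1 (ctr g) [set c in K | dead (g |: S) c && ~~ dead S c].
    by move: fr; move: #|_ :\ _| #|_| (_ \in _) => a1 a2 []; clear; lia.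
  rewrite !inE => /and3P[nc cKc].
  have nb b : inc g c b && inc g c (~~ b) = false.
    apply/negP => /andP[h1 h2]; move: (cKc); rewrite -ctrK => /imsetP [h hX ec].
    have [_ dh] := ctrP h hX; move: nc; rewrite ec; case/eqP; congr ctr.
    apply: (centre_uniq cKc); first by rewrite ec.
    by rewrite /dead_colour !touches1; case: b h1 h2 => /= -> ->.
  rewrite /dead_colour !touchesU1; have := nb false; rewrite /=.
  case i1: (inc g c false); case i2: (inc g c true); case t1: (touches S c false);
    case t2: (touches S c true) => //= _ _; first [exists c, false; split; by rewrite ?t1 ?t2
     | exists c, true; split; by rewrite ?t1 ?t2].
pose cc g := odflt c0 [pick c in K | [exists b, [&& c != ctr g, ~~ touches S c b,
     touches S c (~~ b) & inc g c b]]].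
have ccP g : g \in P -> exists b, [/\ cc g \in K, cc g != ctr g, ~~ touches S (cc g) b,
     touches S (cc g) (~~ b) & inc g (cc g) b].
  move=> gP; rewrite /cc; case: pickP => [c /andP[cKc /existsP [b /and4P[]]]|h]; first by exists b.
  have [c [b [h1 h2 h3 h4 h5]]] := hit g gP; have := h c; rewrite /= h1 /= => /negbT /negP [].
  by apply/existsP; exists b; rewrite h2 h3 h4 h5.
have cc_ends g b : g \in P -> cc g \in K -> cc g != ctr g -> ~~ touches S (cc g) b ->
    touches S (cc g) (~~ b) -> inc g (cc g) b ->
    exists h, [/\ h \in P, h != g & inc h (cc g) b].
  move=> gP h1 h2 h3 h4 h5; move: (h1); rewrite -ctrK => /imsetP [h hX ec].
  exists h; split.
  - rewrite inE hX -ec /half; case: b h3 h4 {h5} => /= /negbTE -> -> //.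
  - by apply: contra h2 => /eqP e; rewrite ec e.
  - by rewrite ec inc_ctr.
(* For distinct [g] and [g'] with [cc g = cc g'], the untouched edge of this colour joins them, and
   the centre of the colour is one of the two, against the choice of [cc]. *)
have cc_inj : {in P &, injective cc}.
  move=> g g' gP gP' e; have [b [h1 h2 h3 h4 h5]] := ccP g gP.
  have [b' [k1 k2 k3 k4 k5]] := ccP g' gP'.
  have eb : b = b'.
    by rewrite -e in k3 k4; case: b b' h3 h4 k3 k4 {h5 k5} => [] [] //= /negbTE -> _ _.
  subst b'; have [h [hP hg ih]] := cc_ends g b gP h1 h2 h3 h4 h5.
  have [h' [hP' hg' ih']] := cc_ends g' b gP' k1 k2 k3 k4 k5.
  rewrite -e in k5 ih' k2.
  have : g' = g \/ g' = h by apply: (inc_two h1 _ h5 ih k5); rewrite eq_sym.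
  case=> // eh; subst h.
  move: (h1); rewrite -ctrK => /imsetP [z zX ez].
  have : z = g \/ z = g'.
    by apply: (inc_two h1 _ h5 ih _); [rewrite eq_sym|rewrite ez inc_ctr].
  by case=> ezz; subst z; rewrite ez eqxx in h2 k2.
pose K' := cc @: P.
have cK' : #|K'| = #|P| by rewrite card_in_imset.
have K'K : K' \subset K by apply/subsetP => _ /imsetP [g /ccP [b [? _ _ _ _]] ->].
pose f c (b : bool) := (c, touches S c false).
pose E' c b := E (f c b).1 (f c b).2.
(* [S] and [P] are disjoint with |P| = |S| + 1, so 2|S| + 1 <= m; evenness of [m] supplies the last
   unit. *)
have p2 : 2 * #|P| <= m.
  have dSP : S \subset X :\: P.
    apply/subsetP => v vS; rewrite inE (subsetP SX _ vS) andbT.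
    by apply/negP => /PS; rewrite vS.
  have := subset_leq_card dSP; rewrite cardsD (setIidPr PX) cX cP.
  by move: em sm; move: #|S|; clear -cX; lia.
apply: noC; apply: (@rcyc_relabel _ _ E E' K K' _ f) => //.
  by move=> c b cK1; apply: (subsetP K'K).
apply: (bound_bundle IH (X := P)).
- by move: p2; rewrite cP; move: #|S|; clear; lia.
- by rewrite cP.
- by rewrite cK'.
- move=> c b /imsetP [g gP ec]; have [b' [h1 h2 h3 h4 h5]] := ccP g gP.
  have [h [hP hg ih]] := cc_ends g b' gP h1 h2 h3 h4 h5.
  have fb : (f c b).2 = b' by rewrite /f /= ec; case: b' h3 h4 {h5 ih} => /= /negbTE // ->.
  rewrite /E' fb ec /=; split.
    have : (E (cc g) b').1 = g \/ (E (cc g) b').1 = h.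
      by apply: (inc_two h1 _ h5 ih); rewrite ?(eq_sym g) // /incident eqxx.
    by case=> ->.
  have : (E (cc g) b').2 = g \/ (E (cc g) b').2 = h.
    by apply: (inc_two h1 _ h5 ih); rewrite ?(eq_sym g) // /incident eqxx orbT.
  by case=> ->.
- by move=> c c' b b' h1 h2 nc; apply: simple => //; apply: (subsetP K'K).
- by move: p2; rewrite cP; move: #|S|; clear; lia.
- have : num_parallel E' K' <= #|K'|.
    by apply: subset_leq_card; apply/subsetP => c; rewrite inE => /andP[].
  by rewrite cK'; move: p2; move: #|P| (num_parallel _ _); clear; lia.
Qed.

Lemma other_end c b v : c \in K -> inc v c b -> exists w, [/\ w \in X, w != v & inc w c b].
Proof.
move=> cKc; have [h1 h2] := hE b cKc; have ne := no_loop b cKc.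
case/orP => /eqP ->; [exists (E c b).2 | exists (E c b).1]; rewrite /incident ?eqxx ?orbT //.
by rewrite eq_sym.
Qed.

Lemma step_of c b u v : u != v -> inc u c b -> inc v c b ->
  exists o, src E (c, b, o) = u /\ tgt E (c, b, o) = v.
Proof.
rewrite /incident /src /tgt /=; case: (E c b) => [a1 a2] /= uv.
case/orP => /eqP h1; case/orP => /eqP h2; subst; rewrite ?eqxx // in uv *.
- by exists false.
- by exists true.
Qed.

Lemma m_gt4 : 4 < m.
Proof.
have [v vX] : exists v, v \in X by apply/set0Pn; rewrite -card_gt0 cX.
pose I := [set e : C * bool | (e.1 \in K) && inc v e.1 e.2].
have cI : #|I| = 4.
  rewrite -(rank1 vX) /touch_rank -sum_pairs_card; apply: eq_bigr => c _; by rewrite !touches1.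
pose oth (e : C * bool) := if (E e.1 e.2).1 == v then (E e.1 e.2).2 else (E e.1 e.2).1.
have othP e : e \in I -> [/\ oth e != v, inc (oth e) e.1 e.2 & oth e \in X].
  rewrite inE => /andP[eK]; rewrite /oth /incident; have := no_loop e.2 eK; have [h1 h2] := hE e.2 eK.
  case: ifP => [/eqP e1|/negbT e1] ne; first by rewrite e1 in ne; split; rewrite ?eqxx ?orbT // eq_sym.
  by rewrite e1 eqxx.
have oi : {in I &, injective oth}.
  move=> [c b] [c' b'] h h'; have [n1 i1 _] := othP _ h; have [n2 i2 _] := othP _ h' => e.
  move: h h'; rewrite !inE /= => /andP[k1 j1] /andP[k2 j2]; rewrite eq_sym in n1.
  have [] := edge_eq k1 k2 n1 j1 i1 j2 _; first by rewrite e.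
  by move=> -> ->.
have := subset_leq_card (_ : oth @: I \subset X :\ v); rewrite card_in_imset // cI.
have := cardsD1 v X; rewrite vX cX => -> h; apply: h.
by apply/subsetP => _ /imsetP [e /othP [h1 _ h2] ->]; rewrite !inE h1.
Qed.

Lemma no_triangle c1 b1 c2 b2 c3 b3 u v w : c1 \in K -> c2 \in K -> c3 \in K ->
  c1 != c2 -> c2 != c3 -> c1 != c3 -> u != v -> v != w -> w != u ->
  inc u c1 b1 -> inc v c1 b1 -> inc v c2 b2 -> inc w c2 b2 -> inc w c3 b3 -> inc u c3 b3 -> False.
Proof.
move=> k1 k2 k3 n1 n2 n3 uv vw wu i1 i2 i3 i4 i5 i6; apply: noC.
have [o1 [p1 q1]] := step_of uv i1 i2; have [o2 [p2 q2]] := step_of vw i3 i4.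
have [o3 [p3 q3]] := step_of wu i5 i6.
apply: rcyc_mono (subxx _) _
  (@rcyc3 _ _ E K (c1, b1, o1) (c2, b2, o2) (c3, b3, o3) _ _ _ _ _ _ _ _ _) => //.
- by rewrite ltnS m_gt4.
- by rewrite q1 p2.
- by rewrite q2 p3.
- by rewrite q3 p1.
Qed.

Lemma fresh_links S w : w \in X -> fresh S w + links S w <= 4.
Proof.
move=> wX; rewrite -(rank1 wX) -big_split; apply: leq_sum => c _ /=.
rewrite /dead_colour !touchesU1 !touches1.
by case: (inc w c false); case: (inc w c true); case: (touches S c false);
   case: (touches S c true).
Qed.

(** * Maximal sets that kill fewer colours than they have vertices *)

Section Maximal.
Variable S : {set T}.
Hypotheses (SX : S \subset X) (s0 : 0 < #|S|) (rS : rank S <= (3 * #|S|).+1)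
  (dS : ndead S < #|S|)
  (mx : forall S', S' \subset X -> rank S' <= (3 * #|S'|).+1 -> ndead S' < #|S'| ->
        #|S'| <= #|S|).

Let nS : (ndead S).+1 = #|S|.
Proof. by apply/eqP; rewrite eqn_leq dS ndead_ge. Qed.

Let sm : #|S| < m.
Proof.
rewrite -cX ltn_neqAle subset_leq_card // andbT; apply/negP => /eqP e.
have eS : S = X by apply: full_sub => //; rewrite e.
by move: dS; rewrite eS ndeadX cX ltnn.
Qed.

Let rSE : rank S = (3 * #|S|).+1.
Proof.
apply/eqP; rewrite eqn_leq rS ltnNge; apply/negP => le.
have := deletion SX; rewrite s0 sm => /(_ isT le).
by move: nS; move: #|S| (ndead S); clear; lia.
Qed.

Let hS : nhalf S = #|S| + 3.
Proof.
have := rankE E K S; rewrite rSE; move: nS.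
by move: #|S| (ndead S) (nhalf S); clear; lia.
Qed.

Section Outside.
Variable w : T.
Hypotheses (wX : w \in X) (wS : w \notin S).

Let cU : #|w |: S| = #|S|.+1.
Proof. by rewrite cardsU1 wS. Qed.

Let UX : w |: S \subset X.
Proof. by rewrite subUset sub1set wX. Qed.

Lemma fresh_gt0 : 0 < fresh S w.
Proof.
have := ndead_ge UX; rewrite cU ndeadU1; move: nS.
by move: #|S| (ndead S) (fresh S w); clear; lia.
Qed.

Lemma fresh_gt1 : 0 < links S w -> 1 < fresh S w.
Proof.
move=> l0; rewrite ltnNge; apply/negP => f1.
have : #|w |: S| <= #|S|.
  apply: mx => //; rewrite cU.
    have := rankU1 E K S w; rewrite rSE rank1 //; move: l0.
    by move: (rank _) (links S w) #|S|; clear; lia.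
  by rewrite ndeadU1; move: nS f1; move: #|S| (ndead S) (fresh S w); clear; lia.
by rewrite cU ltnn.
Qed.

(** With two links, [w |: S] would touch at most 3(|S| + 1) edges, and [deletion] would demand three
    fresh colours; but [fresh_links] leaves room for only two. *)
Lemma links_le1 : links S w <= 1.
Proof.
rewrite leqNgt; apply/negP => l2.
have sm' : #|S|.+1 < m.
  rewrite ltn_neqAle sm andbT; apply/eqP => e.
  have eS : S = X :\ w.
    apply: full_sub.
      apply/subsetP => v vS; rewrite !inE (subsetP SX _ vS) andbT.
      by apply: contraNneq wS => <-.
    by have := cardsD1 w X; rewrite wX cX -e add1n => -[<-].
  by move: nS; rewrite {1}eS ndeadD1; move: sm; move: #|S|; clear; lia.
have r3 : rank (w |: S) <= 3 * #|w |: S|.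
  rewrite cU; have := rankU1 E K S w; rewrite rSE rank1 //; move: l2.
  by move: (rank _) (links S w) #|S|; clear; lia.
have := deletion UX; rewrite cU sm' /= => /(_ isT); rewrite -cU => /(_ r3).
rewrite cU ndeadU1; have := fresh_links S wX; move: nS l2.
by move: #|S| (ndead S) (fresh S w) (links S w); clear; lia.
Qed.

Lemma fresh_ge : links S w < fresh S w.
Proof.
have := links_le1; have := fresh_gt0; have := fresh_gt1.
by move: (fresh S w) (links S w); clear; lia.
Qed.

End Outside.

(** By [fresh_ge] the truncated subtraction is exact on [X :\: S]. *)
Definition excess w := fresh S w - (links S w).+1.

(** Put s = |S|. There are s - 1 dead and s + 3 half-touched colours, so [fresh_sum] allows m + 4
    fresh ones in total. [links_sum] gives 2s + 2 links, and each of the m - s outside vertices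
    takes one more; 2 - s is left. *)
Lemma excess_sum : \sum_(w in X :\: S) excess w + #|S| <= 2.
Proof.
have h : \sum_(w in X :\: S) fresh S w =
   \sum_(w in X :\: S) excess w + (\sum_(w in X :\: S) links S w + #|X :\: S|).
  rewrite -sum1_card -!big_split; apply: eq_bigr => w; rewrite inE => /andP[wS wX] /=.
  by have := fresh_ge wX wS; rewrite /excess; move: (fresh S w) (links S w); clear; lia.
have := fresh_sum SX; have := links_sum SX; rewrite h hS rSE cardsD (setIidPr SX) cX.
move: nS sm; move: (\sum_(w in _) excess w) (\sum_(w in _) links S w) (ndead S) #|S|.
by clear; lia.
Qed.

Lemma s_le2 : #|S| <= 2.
Proof. by have := excess_sum; move: (\sum_(w in _) _) #|S|; clear; lia. Qed.

(** The untouched edge of a half-touched colour, seen from one end: adding [w] to [S] kills the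
    colour. *)
Definition end_edge w (e : C * bool) :=
  [&& e.1 \in K, inc w e.1 e.2, ~~ touches S e.1 e.2 & touches S e.1 (~~ e.2)].

(** Without such a colour, adding both [w] and [z] kills too little: [c1] is fresh for each of them,
    so it is counted twice, and a colour that dies only when both are added is the one sought. The
    edge from [w] to [z] also saves a touched edge. If [z] has no link to [S], maximality is
    violated; if it has one, [deletion] is. *)
Lemma cross w z c1 b1 : w \in X -> w \notin S -> z \in X -> z \notin S -> w != z ->
  links S w = 1 -> excess w = 0 -> excess z = 0 ->
  end_edge w (c1, b1) -> inc z c1 b1 ->
  exists c b, [/\ c \in K, inc w c b, inc z c (~~ b), ~~ touches S c b & ~~ touches S c (~~ b)].
Proof.
move=> wX wS zX zS wz lw ew ez /and4P[/= c1K iw nt t] iz.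
have fw : fresh S w = 2.
  have := fresh_ge wX wS; move: ew; rewrite /excess lw; move: (fresh S w); clear; lia.
have fz : fresh S z = (links S z).+1.
  have := fresh_ge zX zS; move: ez; rewrite /excess; move: (fresh S z) (links S z); clear; lia.
have [/existsP [c /existsP [b /and5P[]]]|nex] := boolP [exists c, exists b,
   [&& c \in K, inc w c b, inc z c (~~ b), ~~ touches S c b & ~~ touches S c (~~ b)]].
  by exists c, b.
exfalso; have {}nex c b : c \in K -> inc w c b -> inc z c (~~ b) ->
    touches S c b || touches S c (~~ b).
  move=> k1 k2 k3; apply: contraNT nex; rewrite negb_or => /andP[k4 k5].
  by apply/existsP; exists c; apply/existsP; exists b; rewrite k1 k2 k3 k4 k5.
set S2 := z |: (w |: S).
have S2X : S2 \subset X by rewrite !subUset !sub1set zX wX.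
have cS2 : #|S2| = #|S|.+2 by rewrite !cardsU1 wS !inE negb_or (eq_sym z) wz zS.
have one : \sum_(c in K) (c == c1 : nat) = 1.
  by rewrite (big_setD1 c1 c1K) /= eqxx big1 // => c; rewrite !inE => /andP[/negbTE ->].
have d2 : ndead S2 + ndead S + 1 <= ndead (w |: S) + ndead (z |: S).
  rewrite -one -!big_split; apply: leq_sum => c cKc /=.
  have n1 := nex c false cKc; have n2 := nex c true cKc.
  rewrite /S2 /dead_colour !touchesU1; have [ec|nc] := eqVneq c c1.
    subst c; move: iw iz nt t {n1 n2}; case: b1 => /= -> -> /negbTE -> -> /=; rewrite ?orbT //.
  move: n1 n2 => /=; case: (inc w c false); case: (inc w c true); case: (inc z c false);
    case: (inc z c true); case: (touches S c false); case: (touches S c true) => //= n1 n2;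
    by [move: (n1 isT isT) | move: (n2 isT isT)].
have l2 : links S z + 1 <= links (w |: S) z.
  rewrite -one -big_split; apply: leq_sum => c cKc /=; rewrite !touchesU1.
  have [ec|nc] := eqVneq c c1; last first.
    by case: (inc z c false); case: (inc z c true); case: (touches S c false);
       case: (touches S c true); case: (inc w c false); case: (inc w c true).
  subst c; move: iw iz nt; case: b1 {t} => /= -> -> /negbTE -> /=; rewrite ?addn0 ?addn1 //.
    by case: (inc z c1 false); case: (touches S c1 false); rewrite ?orbT.
  by case: (inc z c1 true); case: (touches S c1 true); rewrite ?orbT.
have r2 := rankU1 E K (w |: S) z; have r1 := rankU1 E K S w.
rewrite !rank1 // rSE lw in r1 r2.
have dw := ndeadU1 E K S w; have dz := ndeadU1 E K S z; rewrite fw fz in dw dz.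
have lz := links_le1 zX zS.
have [l0|l1] := posnP (links S z).
  have : #|S2| <= #|S|.
    apply: mx => //; rewrite cS2.
      move: r2 r1 l2; rewrite -/S2 l0.
      by move: (rank S2) (rank (w |: S)) (links (w |: S) z) #|S|; clear; lia.
    move: d2 dw dz nS; rewrite l0.
    by move: (ndead S2) (ndead (w |: S)) (ndead (z |: S)) (ndead S) #|S|; clear; lia.
  by rewrite cS2; move: #|S|; clear; lia.
have r3 : rank S2 <= 3 * #|S2|.
  rewrite cS2; move: r2 r1 l2 l1; rewrite -/S2.
  by move: (rank S2) (rank (w |: S)) (links (w |: S) z) (links S z) #|S|; clear; lia.
have := deletion S2X; rewrite cS2.
have -> : 0 < #|S|.+2 < m by have := s_le2; have := m_gt4; move: #|S|; clear; lia.
move=> /(_ isT); rewrite -cS2 => /(_ r3); rewrite cS2; move: d2 dw dz nS lz.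
by move: (ndead S2) (ndead (w |: S)) (ndead (z |: S)) (ndead S) (links S z) #|S|; clear; lia.
Qed.

Definition ends w := [set e | end_edge w e].

Lemma ends_le w : #|ends w| <= fresh S w.
Proof.
rewrite -[X in X <= _](_ : \sum_(c in K)
   ([&& inc w c false, ~~ touches S c false & touches S c true]
    + [&& inc w c true, ~~ touches S c true & touches S c false]) = _).
  apply: leq_sum => c _; rewrite /dead_colour !touchesU1.
  by case: (inc w c false); case: (inc w c true); case: (touches S c false);
     case: (touches S c true).
rewrite (sum_pairs_card K (fun c b => [&& inc w c b, ~~ touches S c b & touches S c (~~ b)])).
by apply: eq_card => e; rewrite !inE.
Qed.

(** Three edges at [w] avoid [S]. Each of the two fresh colours accounts for one end edge or for two
    edges of [H], so 2|ends w| + |H| = 4 while |ends w| + |H| <= 3. A further edge outside both sets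
    forces two end edges and leaves no room for anything else. *)
Lemma ends_count w : w \in X -> links S w = 1 -> fresh S w = 2 ->
  0 < #|ends w| /\
  forall c b, c \in K -> inc w c b -> ~~ inc w c (~~ b) -> ~~ touches S c b ->
    ~~ touches S c (~~ b) -> #|ends w| = 2 /\
    forall e, e.1 \in K -> inc w e.1 e.2 -> ~~ touches S e.1 e.2 ->
      e \in ends w \/ e = (c, b).
Proof.
move=> wX lw fw.
pose U := [set e : C * bool | (e.1 \in K) && (inc w e.1 e.2 && ~~ touches S e.1 e.2)].
have cU : #|U| = 3.
  have := rank1 wX; rewrite -[rank _](_ : links S w + #|U| = _); first by rewrite lw => -[].
  rewrite -(sum_pairs_card K (fun c b => inc w c b && ~~ touches S c b)) -big_split.
  apply: eq_bigr => c _ /=; rewrite !touches1.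
  by case: (inc w c false); case: (inc w c true); case: (touches S c false);
     case: (touches S c true).
pose H := [set e : C * bool | (e.1 \in K) && [&& inc w e.1 e.2, ~~ touches S e.1 e.2,
   inc w e.1 (~~ e.2) & ~~ touches S e.1 (~~ e.2)]].
have cE : #|ends w| = #|[set e : C * bool | (e.1 \in K) && [&& inc w e.1 e.2,
     ~~ touches S e.1 e.2 & touches S e.1 (~~ e.2)]]| by apply: eq_card => e; rewrite !inE.
have cH : 4 = #|ends w| * 2 + #|H|.
  rewrite -[4]/(2 * 2) -{1}fw cE.
  rewrite -(sum_pairs_card K (fun c b => [&& inc w c b, ~~ touches S c b & touches S c (~~ b)])).
  rewrite -(sum_pairs_card K (fun c b => [&& inc w c b, ~~ touches S c b,
    inc w c (~~ b) & ~~ touches S c (~~ b)])).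
  rewrite !big_distrl -big_split; apply: eq_bigr => c _ /=; rewrite /dead_colour !touchesU1.
  by case: (inc w c false); case: (inc w c true); case: (touches S c false);
     case: (touches S c true).
have eU : ends w \subset U by apply/subsetP => e; rewrite !inE => /and4P[-> -> -> _].
have dis : [disjoint ends w & H].
  apply/pred0P => e /=; rewrite !inE; apply/negP => /andP[/and4P[_ _ _ h1] /and5P[_ _ _ _ h2]].
  by rewrite h1 in h2.
have UH : ends w :|: H \subset U.
  rewrite subUset eU; apply/subsetP => e; rewrite !inE => /and5P[-> -> -> _ _] //.
have cUH : #|ends w :|: H| = #|ends w| + #|H|.
  by rewrite cardsU (disjoint_setI0 dis) cards0 subn0.
split.
  have := subset_leq_card UH; rewrite cUH cU; move: cH.
  by move: #|ends w| #|H|; clear; lia.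
move=> c b cKc ic nic ntc ntc'.
have gU : (c, b) \in U by rewrite !inE cKc ic ntc.
have gE : (c, b) \notin ends w by rewrite !inE /end_edge /= (negbTE ntc') !andbF.
have gH : (c, b) \notin H by rewrite !inE /= (negbTE nic) !andbF.
have UH' : ends w :|: H \subset U :\ (c, b).
  apply/subsetP => e eUH; rewrite in_setD1 (subsetP UH _ eUH) andbT.
  by apply: contraTneq eUH => ->; rewrite in_setU negb_or gE gH.
have cU' := cardsD1 (c, b) U; rewrite gU cU in cU'.
have := subset_leq_card UH'; rewrite cUH => le.
have e2 : #|ends w| = 2.
  by move: cH le cU'; move: #|ends w| #|H| #|U :\ (c, b)|; clear; lia.
split=> // e h1 h2 h3; have [->|ne] := eqVneq e (c, b); [by right | left].
have <- : U :\ (c, b) = ends w.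
  apply/esym/full_sub; last by rewrite e2; move: cU'; move: #|_|; clear; lia.
  by apply: subset_trans UH'; apply: subsetUl.
by rewrite !inE ne h1 h2 h3.
Qed.

Lemma end_edge_notin w z e : end_edge w e -> inc z e.1 e.2 -> z \notin S.
Proof. by case/and4P=> _ _ nt _ iz; apply: contra nt => zS; apply/touchesP; exists z. Qed.

(** Otherwise [cross] applies to every end edge of [w]. The crossing colour occupies the only
    remaining edge at [w], so there are two end edges, to [z1] and [z2], and the same colour crosses
    to both. Its other edge joins [z1] to [z2] and closes a rainbow triangle. *)
Lemma attach w : w \in X -> w \notin S -> links S w = 1 -> excess w = 0 ->
  exists e z, [/\ end_edge w e, z \in X :\: S, z != w, inc z e.1 e.2 & 0 < excess z].
Proof.
move=> wX wS lw ew.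
have fw : fresh S w = 2.
  have := fresh_ge wX wS; move: ew; rewrite /excess lw; move: (fresh S w); clear; lia.
have [en0 cnt] := ends_count wX lw fw.
have [/existsP [e /existsP [z /and5P[]]]|nex] := boolP [exists e, exists z,
   [&& end_edge w e, z \in X :\: S, z != w, inc z e.1 e.2 & 0 < excess z]].
  by exists e, z.
exfalso.
have {}nex c b : end_edge w (c, b) -> exists z, [/\ z != w, inc z c b &
    exists c' b', [/\ c' \in K, inc w c' b', inc z c' (~~ b'),
      ~~ touches S c' b' & ~~ touches S c' (~~ b')]].
  move=> ee; have /and4P[/= cKc iw nt t] := ee.
  have [z [zX zw iz]] := other_end cKc iw; have zS := end_edge_notin ee iz.
  exists z; split=> //; apply: cross (ee) (iz) => //; first by rewrite eq_sym.
  apply/eqP; rewrite -leqn0 leqNgt; apply: contra nex => ez.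
  by apply/existsP; exists (c, b); apply/existsP; exists z; rewrite ee inE zX zS zw iz.
have ncross c b c' b' z : end_edge w (c, b) -> z != w -> inc z c b -> c' \in K ->
    inc w c' b' -> inc z c' (~~ b') -> ~~ touches S c' b' -> ~~ inc w c' (~~ b').
  move=> /and4P[/= h1 h2 h3 h4] zw iz k1 k2 k3 k4; apply/negP => k5; rewrite eq_sym in zw.
  have [ec eb] := edge_eq h1 k1 zw h2 iz k5 k3; subst c b.
  by move: h4; rewrite negbK (negbTE k4).
have [[c1 b1]] : exists e, e \in ends w by apply/set0Pn; rewrite -card_gt0.
rewrite inE => ee1; have [z1 [zw1 iz1 [c [b [cKc icw icz nt nt']]]]] := nex _ _ ee1.
have [c2e all2] := cnt c b cKc icw (ncross _ _ _ _ _ ee1 zw1 iz1 cKc icw icz nt) nt nt'.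
have [[c2 b2]] : exists e, e \in ends w :\ (c1, b1).
  apply/set0Pn; rewrite -card_gt0; have := cardsD1 (c1, b1) (ends w).
  by rewrite inE ee1 c2e; move: #|_|; clear; lia.
rewrite in_setD1 [_ \in ends w]inE => /andP[ne12 ee2].
have [z2 [zw2 iz2 [c' [b' [cKc' icw' icz' nt2 nt2']]]]] := nex _ _ ee2.
have [|[ec eb]] := all2 (c', b') cKc' icw' nt2.
  by rewrite inE => /and4P[_ _ _ /=]; rewrite (negbTE nt2').
subst c' b'; have /and4P[/= k1 i1 u1 t1] := ee1; have /and4P[/= k2 i2 u2 t2] := ee2.
have n1c : c1 != c.
  apply: contraTneq t1 => ->; by case: (b1) (b) nt nt' => [] [] //= ? ?.
have n2c : c2 != c.
  apply: contraTneq t2 => ->; by case: (b2) (b) nt nt' => [] [] //= ? ?.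
have n12 : c1 != c2.
  apply: contraNneq ne12 => e; subst c2; apply/eqP; congr pair.
  by move: u1 t1 u2 t2; case: (b1); case: (b2) => //= /negbTE ->.
have z12 : z1 != z2.
  apply: contraNneq n12 => e; subst z2; rewrite eq_sym in zw1.
  by have [-> _] := edge_eq k1 k2 zw1 i1 iz1 i2 iz2.
apply: (@no_triangle c1 b1 c (~~ b) c2 b2 w z1 z2) => //; first by rewrite eq_sym.
by rewrite eq_sym.
Qed.

Lemma linksP w : 0 < links S w -> exists c b, [/\ c \in K, inc w c b & touches S c b].
Proof.
rewrite /num_links (sum_pairs_card K (fun c b => inc w c b && touches S c b)) card_gt0.
by case/set0Pn => -[c b]; rewrite inE => /and3P[h1 h2 h3]; exists c, b.
Qed.

Lemma links_gt0 w c b : c \in K -> inc w c b -> touches S c b -> 0 < links S w.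
Proof.
move=> h1 h2 h3; rewrite /num_links (sum_pairs_card K (fun c b => inc w c b && touches S c b)).
by rewrite card_gt0; apply/set0Pn; exists (c, b); rewrite inE /= h1 h2.
Qed.

Lemma excess_vertex : exists2 z, z \in X :\: S & 0 < excess z.
Proof.
have [w wXS lw] : exists2 w, w \in X :\: S & 0 < links S w.
  have [/exists_inP //|/exists_inPn h] := boolP [exists w in X :\: S, 0 < links S w].
  have := links_sum SX; rewrite rSE big1; first by move: #|S|; clear; lia.
  by move=> w /h; rewrite lt0n negbK => /eqP.
have := wXS; rewrite inE => /andP[wS wX].
have [e0|] := posnP (excess w); last by exists w.
have l1 : links S w = 1 by apply/eqP; rewrite eqn_leq links_le1.
by have [e [z [_ zXS _ _ ez]]] := attach wX wS l1 e0; exists z.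
Qed.

(** Since some vertex has positive excess, the budget 2 - |S| leaves |S| = 1 and a single vertex [y]
    with excess, equal to one. Apart from [y] itself, each neighbour of [v] is attached to [y] by an
    end edge, which makes the neighbourhood of [v] rigid enough to be contracted. *)
Lemma no_maximal : False.
Proof.
have [y yXS ey] := excess_vertex.
have := excess_sum; rewrite (big_setD1 y yXS) /= => le.
have s1 : #|S| = 1 by move: le ey s0; move: #|S| (excess y) (\sum_(w in _) _); clear; lia.
have ey1 : excess y = 1 by move: le ey s0; move: #|S| (excess y) (\sum_(w in _) _); clear; lia.
have ex0 w : w \in X :\: S -> w != y -> excess w = 0.
  move=> wXS wy; have : \sum_(w in (X :\: S) :\ y) excess w = 0.
    by move: le ey s0; move: #|S| (excess y) (\sum_(w in _) _); clear; lia.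
  move/eqP; rewrite sum_nat_eq0 => /forall_inP /(_ w); rewrite in_setD1 wy => /(_ wXS) /eqP //.
have nd0 c : c \in K -> ~~ dead S c.
  move=> cKc; apply/negP => dc; have := nS; rewrite s1 /num_dead (big_setD1 c cKc) /= dc.
  by move: (\sum_(i in _) _); clear; lia.
have /cards1P [v eS] : #|S| == 1 by rewrite s1.
have vX : v \in X by apply: (subsetP SX); rewrite eS inE.
have tv c b : touches S c b = inc v c b by rewrite eS touches1.
pose W := [set w in X :\: S | links S w == 1].
have WXS w : w \in W -> [/\ w \in X, w \notin S & links S w = 1].
  by rewrite !inE => /andP[/andP[h1 h2] /eqP].
have Wv w : w \in W -> w != v by case/WXS => _ wS _; apply: contraNneq wS => ->; rewrite eS inE.
have cW : #|W| = 4.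
  rewrite -sum_bool_card (_ : \sum_(w in _) _ = \sum_(w in X :\: S) links S w); last first.
    apply: eq_bigr => w; rewrite inE => /andP[wS wX]; have := links_le1 wX wS.
    by move: (links S w) => [|[|]].
  by have := links_sum SX; rewrite rSE s1; move: (\sum_(i in _) _); clear; lia.
have inW c b w : c \in K -> inc v c b -> inc w c b -> w != v -> w \in W.
  move=> h1 h2 h3 wv; have wX := inc_in h1 h3; have wS : w \notin S by rewrite eS inE.
  rewrite !inE wS wX /= eqn_leq links_le1 //= (links_gt0 (c := c) (b := b)) //.
  by rewrite tv.
pose pe w := [pick e | end_edge w e && inc y e.1 e.2].
have att w : w \in W -> w != y -> exists2 e, pe w = Some e & end_edge w e && inc y e.1 e.2.
  move=> wW wy; rewrite /pe; case: pickP => [e he|none]; first by exists e.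
  have [wX wS lw] := WXS w wW; have wXS : w \in X :\: S by rewrite inE wS.
  have [e [z [h1 h2 h3 h4 h5]]] := attach wX wS lw (ex0 w wXS wy).
  have ez : z = y by apply/eqP; apply/negPn/negP => zy; rewrite (ex0 z) in h5.
  by have := none e; rewrite h1 -ez h4.
have [c0 c0K] : exists c, c \in K by apply/set0Pn; rewrite -card_gt0 cK.
pose ee w := odflt (c0, false) (pe w).
have eeP w : w \in W -> w != y -> [/\ end_edge w (ee w), inc y (ee w).1 (ee w).2 & ee w \in ends y].
  move=> wW wy; have [e h /andP[h1 h2]] := att w wW wy; rewrite /ee h /=; split=> //.
  by rewrite inE /end_edge h2; case/and4P: h1 => -> _ -> ->.
have yS : y \notin S by move: yXS; rewrite inE => /andP[].
have yX : y \in X by move: yXS; rewrite inE => /andP[].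
have ee_inj : {in W :\ y &, injective ee}.
  move=> w w'; rewrite !in_setD1 => /andP[wy wW] /andP[wy' wW'] e.
  have [h1 h2 _] := eeP w wW wy; have [h3 _ _] := eeP w' wW' wy'.
  move: h1 h3; rewrite -e => /and4P[k1 k2 _ _] /and4P[_ k3 _ _].
  by case: (inc_two k1 wy k2 h2 k3) => // e'; rewrite e' eqxx in wy'.
have sub : ee @: (W :\ y) \subset ends y.
  apply/subsetP => _ /imsetP [w wD ->]; move: wD; rewrite in_setD1 => /andP[wy wW].
  by have [] := eeP w wW wy.
have le1 := subset_leq_card sub; rewrite card_in_imset // in le1.
have le2 := ends_le y; have fy := fresh_ge yX yS; have ly := links_le1 yX yS.
have cWy := cardsD1 y W; rewrite cW in cWy.
(* Outside [W], the vertex [y] would have two fresh colours and so at most two end edges, but four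
   vertices attached to it. *)
have yW : y \in W.
  apply/negPn/negP => yW; rewrite (negbTE yW) in cWy.
  have l0 : links S y = 0.
    by apply/eqP; move: yW ly; rewrite !inE yS yX /=; move: (links S y) => [|[|]].
  move: ey1 cWy le1 le2 fy; rewrite /excess l0.
  by move: #|_ :\ _| #|ends y| (fresh S y); clear; lia.
rewrite yW in cWy; have [_ _ ly1] := WXS y yW.
have cEy : #|ends y| = 3.
  move: ey1 cWy le1 le2 fy; rewrite /excess ly1.
  by move: #|_ :\ _| #|ends y| (fresh S y); clear; lia.
have eEy : ee @: (W :\ y) = ends y.
  by apply: full_sub => //; rewrite card_in_imset // cEy; move: cWy; move: #|_|; clear; lia.
(* No colour has [v] on both edges, so the four edges at [v] have four different colours; all edges
   at [y] have these colours too. *)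
pose D := [set c in K | touches S c false (+) touches S c true].
have cD : #|D| = 4 by rewrite -sum_bool_card -/(nhalf S) hS s1.
have DK : D \subset K by apply/subsetP => c; rewrite inE => /andP[].
have inD c b : c \in K -> inc v c b -> c \in D.
  move=> cKc iv; rewrite inE cKc /=; have := nd0 c cKc; rewrite /dead_colour !tv.
  by case: b iv => ->; case: (inc v c _).
have notD c b : c \in K :\: D -> inc v c b = false.
  by rewrite inE => /andP[cD' cKc]; apply/negP => iv; rewrite (inD c b) in cD'.
have yD c b : c \in K -> inc y c b -> c \in D.
  move=> cKc iy; have [tc|tc] := boolP (touches S c b).
    by rewrite tv in tc; apply: inD tc.
  suff : (c, b) \in ends y by rewrite inE => /and4P[_ _ _ /=]; rewrite tv; apply: inD.
  pose U := [set e : C * bool | (e.1 \in K) && (inc y e.1 e.2 && ~~ touches S e.1 e.2)].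
  have cU : #|U| = 3.
    have := rank1 yX; rewrite -[rank _](_ : links S y + #|U| = _); first by rewrite ly1 => -[].
    rewrite -(sum_pairs_card K (fun c b => inc y c b && ~~ touches S c b)) -big_split.
    apply: eq_bigr => c' _ /=; rewrite !touches1.
    by case: (inc y c' false); case: (inc y c' true); case: (touches S c' false);
       case: (touches S c' true).
  rewrite (_ : ends y = U); first by rewrite !inE /= cKc iy tc.
  apply: full_sub; last by rewrite cU cEy.
  by apply/subsetP => e; rewrite !inE => /and4P[-> -> -> _].
pose Z := [set e : C * bool | (e.1 \in K) && (~~ touches S e.1 e.2 && touches S e.1 (~~ e.2))].
have cZ : #|Z| = 4.
  rewrite -[4](_ : nhalf S = _); last by rewrite hS s1.
  rewrite -(sum_pairs_card K (fun c b => ~~ touches S c b && touches S c (~~ b))).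
  by apply: eq_bigr => c _ /=; case: (touches S c false); case: (touches S c true).
have endsZ w : ends w \subset Z by apply/subsetP => e; rewrite !inE => /and4P[-> _ -> ->].
have Zclass c b c' b' : (c, b) \in Z -> (c', b') \in Z -> (c, b) != (c', b') -> c != c'.
  rewrite !inE /= => /and3P[_ h1 h2] /and3P[_ h3 h4]; apply: contraNneq => e; subst c'.
  apply/eqP; congr pair.
  by move: h1 h2 h3 h4; case: (b); case: (b') => //= /negbTE ->.
have spoke w : w \in W -> exists c b, [/\ c \in D, inc w c b & inc v c b].
  case/WXS => _ _ lw; have [|c [b [h1 h2 h3]]] := @linksP w; first by rewrite lw.
  by rewrite tv in h3; exists c, b; split=> //; apply: inD h3.
have spoke2 w w' c b c' b' : w \in W -> w' \in W -> w != w' -> c \in D -> c' \in D ->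
    inc w c b -> inc v c b -> inc w' c' b' -> inc v c' b' -> c != c'.
  move=> wW wW' ww' cD1 cD2 h1 h2 h3 h4; apply/eqP => e; subst c'.
  have cKc := subsetP DK _ cD1; have [eb|nb] := eqVneq b b'.
    subst b'; have [e|e] := inc_two cKc ww' h1 h3 h2.
      by have := Wv w wW; rewrite e eqxx.
    by have := Wv w' wW'; rewrite e eqxx.
  have := nd0 c cKc; rewrite /dead_colour !tv.
  by case: (b) (b') nb h2 h4 => [] [] // _ -> ->.
pose Q := v |: W.
have cQ : #|Q| = 5 by rewrite cardsU1 cW; case vW: (v \in W) => //; have := Wv v vW; rewrite eqxx.
have QX : Q \subset X by rewrite subUset sub1set vX; apply/subsetP => w /WXS [].
have vQ : v \in Q by rewrite setU11.
have conn a a' : a \in Q -> a' \in Q -> exists l, [/\ walk E a l a', rainbow D l & size l <= 2].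
  have [->|aa] := eqVneq a a'; first by exists [::]; rewrite /= eqxx.
  move=> /setU1P[ea|aW] /setU1P[ea'|aW'].
  - by rewrite ea ea' eqxx in aa.
  - have [c [k [cD1 h1 h2]]] := spoke a' aW'; rewrite -ea in h2; have [o [p1 p2]] := step_of aa h2 h1.
    by exists [:: (c, k, o)]; rewrite /= /rainbow /= p1 p2 !eqxx cD1.
  - have [c [k [cD1 h1 h2]]] := spoke a aW; rewrite -ea' in h2; have [o [p1 p2]] := step_of aa h1 h2.
    by exists [:: (c, k, o)]; rewrite /= /rainbow /= p1 p2 !eqxx cD1.
  - have [c [k [cD1 h1 h2]]] := spoke a aW; have [c' [k' [cD2 h3 h4]]] := spoke a' aW'.
    have [o [p1 p2]] := step_of (Wv a aW) h1 h2.
    have va : v != a' by rewrite eq_sym Wv.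
    have [o' [p3 p4]] := step_of va h4 h3.
    exists [:: (c, k, o); (c', k', o')]; rewrite /= /rainbow /= p1 p2 p3 p4 !eqxx.
    by rewrite inE (spoke2 a a' c k c' k') // /col /= cD1 cD2.
have cX' := card_contract vQ QX; rewrite cQ cX in cX'.
have cK' : #|K :\: D| = m - 4 by rewrite cardsD (setIidPr DK) cK cD.
have inQ c b w : c \in K :\: D -> inc w c b -> w \in Q -> w \in W /\ w != y.
  move=> cKD iw /setU1P[ew|wW]; first by have := notD c b cKD; rewrite -ew iw.
  have cKc : c \in K by move: cKD; rewrite inE => /andP[].
  by split=> //; apply: contraTneq cKD => ewy; rewrite inE (yD c b) // -ewy.
have noin c b a a' : c \in K :\: D -> a != a' -> inc a c b -> inc a' c b ->
    a \in Q -> a' \in Q -> False.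
  move=> cKD aa ia ia' /(inQ _ _ _ cKD ia) [aW _] /(inQ _ _ _ cKD ia') [aW' _].
  have [c1 [b1 [h1 h2 h3]]] := spoke a aW; have [c2 [b2 [h4 h5 h6]]] := spoke a' aW'.
  have cKc : c \in K by move: cKD; rewrite inE => /andP[].
  have nD d : d \in D -> c != d by move=> dD; apply: contraTneq cKD => ->; rewrite inE dD.
  apply: (@no_triangle c1 b1 c b c2 b2 v a a') => //.
  - exact: (subsetP DK).
  - exact: (subsetP DK).
  - by rewrite eq_sym nD.
  - exact: nD.
  - exact: (spoke2 a a' c1 b1 c2 b2).
  - by rewrite eq_sym Wv.
  - exact: Wv.
(* Contracting five vertices with four colours and diameter two costs exactly what it saves, (m - 4)
   + 1 + 4 = m + 1; hence no colour may become parallel. *)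
apply: noC; apply: (@rcyc_mono _ _ _ K K ((m - 4).+1 + 2.*2)) => //.
  by have := m_gt4; clear; lia.
apply: (rcyc_contract vQ DK conn).
have np0 : num_parallel (contractE E Q v) (K :\: D) = 0.
  apply/eqP; rewrite cards_eq0; apply/eqP/setP => c; rewrite [RHS]inE; apply/negP.
  rewrite inE => /andP[cKD pc]; have := cKD; rewrite in_setD => /andP[cD' cKc].
  move: pc; case/same_endsP => o; rewrite !contract_src !contract_tgt.
  case=> /(contract_eq vQ) h1 /(contract_eq vQ) h2.
  have npc := not_parallel cKc.
  have isrc s : inc (src E s) s.1.1 s.1.2 by rewrite /src /incident; case: s.2; rewrite eqxx ?orbT.
  have itgt s : inc (tgt E s) s.1.1 s.1.2 by rewrite /tgt /incident; case: s.2; rewrite eqxx ?orbT.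
  have nst s : col s = c -> src E s != tgt E s.
    move=> ec; have := no_loop s.1.2 cKc; rewrite -ec /src /tgt /col.
    by case: s.2 => //; rewrite eq_sym.
  (* The two edges lead to neighbours [t1] and [t2] of [v] other than [y]. At each of them
     [ends_count] yields a second end edge besides the one to [y]. Only one edge of [Z] is not at
     [y], so the two coincide in an edge between [t1] and [t2], and [y], [t1], [t2] form a rainbow
     triangle. *)
  have bad st1 st2 : st1.1 = (c, false) -> st2.1 = (c, true) -> src E st1 = src E st2 ->
      tgt E st1 \in Q -> tgt E st2 \in Q -> False.
    move=> e1 e2 es t1Q t2Q.
    have := isrc st1; have := itgt st1; have := isrc st2; have := itgt st2.
    have := nst st1; have := nst st2; rewrite /col e1 e2 /= => /(_ erefl) n2 /(_ erefl) n1.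
    move: t1Q t2Q n1 n2; rewrite -es; move: (src E st1) (tgt E st1) (tgt E st2) => z t1 t2.
    move=> t1Q t2Q n1 n2 i2 j2 i1 j1 {e1 e2 es st1 st2}.
    have t12 : t1 != t2.
      apply: contraNneq npc => e; rewrite -e in i2 n2; exact: same_ends_inc n1 j1 i1 j2 i2.
    have [t1W t1y] := inQ c false t1 cKD i1 t1Q; have [t2W t2y] := inQ c true t2 cKD i2 t2Q.
    have two t b' : t \in W -> t != y -> inc t c b' -> ~~ inc t c (~~ b') ->
        exists f, [/\ f \in ends t, f \notin ends y & f \in Z].
      move=> tW ty it nit; have [tX tS lt] := WXS t tW.
      have tXS : t \in X :\: S by rewrite inE tS.
      have ft : fresh S t = 2.
        have := fresh_ge tX tS; have := ex0 t tXS ty; rewrite /excess lt.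
        by move: (fresh S t); clear; lia.
      have [_ cnt] := ends_count tX lt ft.
      have [] := cnt c b' cKc it nit; rewrite ?tv ?notD // => c2 _.
      have [h1' h2' h3'] := eeP t tW ty.
      have [f] : exists f, f \in ends t :\ ee t.
        apply/set0Pn; rewrite -card_gt0; have := cardsD1 (ee t) (ends t).
        by rewrite c2 [ee t \in _]inE h1'; move: #|_|; clear; lia.
      rewrite in_setD1 => /andP[fe ft']; exists f; split=> //; last exact: (subsetP (endsZ t)).
      apply: contra fe => fy'; move: ft' fy' h1'; rewrite !inE => /and4P[k1 k2 _ _] /and4P[_ k3 _ _].
      case/and4P => k4 k5 _ _; have [] := edge_eq k1 k4 ty k2 k3 k5 h2'.
      by case: (f) (ee t) => [? ?] [? ?] /= -> ->.
    have z1 : ~~ inc t1 c true.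
      apply/negP => h; have [e|e] := inc_two cKc n2 j2 i2 h; first by rewrite e eqxx in n1.
      by rewrite e eqxx in t12.
    have z2 : ~~ inc t2 c false.
      apply/negP => h; have [e|e] := inc_two cKc n1 j1 i1 h; first by rewrite e eqxx in n2.
      by rewrite e eqxx in t12.
    have [f1 [g1 g2 g3]] := two t1 false t1W t1y i1 z1.
    have [f2 [g4 g5 g6]] := two t2 true t2W t2y i2 z2.
    have cZ' : #|Z :\: ends y| = 1 by rewrite cardsD (setIidPr (endsZ y)) cZ cEy.
    have /cards1P [f eZ] : #|Z :\: ends y| == 1 by rewrite cZ'.
    have ef1 : f1 = f by apply/eqP; rewrite -in_set1 -eZ inE g2.
    have ef2 : f2 = f by apply/eqP; rewrite -in_set1 -eZ inE g5.
    subst f1 f2; have [k1 k2 k3] := eeP t1 t1W t1y; have [k4 k5 k6] := eeP t2 t2W t2y.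
    move: g1 g4; rewrite !inE => /and4P[m1 m2 _ _] /and4P[_ m3 _ _].
    have fne e : e \in ends y -> e.1 != f.1.
      move=> ey'; case: (e) (f) ey' g2 g3 => [a1 a2] [d1 d2] /= q1 q2 q3.
      apply: (Zclass _ a2 _ d2) => //; first exact: (subsetP (endsZ y)).
      by apply: contraTneq q1 => ->.
    have ne12 : (ee t1).1 != (ee t2).1.
      have : ee t1 != ee t2.
        apply: contraNneq t12 => e; apply/eqP; apply: ee_inj => //; by rewrite in_setD1 ?t1y ?t2y.
      move: (subsetP (endsZ y) _ k3) (subsetP (endsZ y) _ k6).
      by case: (ee t1) (ee t2) => [? ?] [? ?]; apply: Zclass.
    case/and4P: k1 => k1a k1b _ _; case/and4P: k4 => k4a k4b _ _.
    apply: (@no_triangle (ee t1).1 (ee t1).2 f.1 f.2 (ee t2).1 (ee t2).2 y t1 t2) => //.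
    - exact: fne.
    - by rewrite eq_sym; apply: fne.
    - by rewrite eq_sym.
  case: h1 h2 => [h1|[h1 h1']] [h2|[h2 h2']].
  - by case/negP: npc; apply/same_endsP; exists o.
  - exact: (bad (c, false, false) (c, true, o)).
  - by apply: (bad (flip (c, false, false)) (flip (c, true, o))); rewrite ?src_flip ?tgt_flip.
  - apply: (noin c false _ _ cKD (nst (c, false, false) erefl) _ _ h1 h2).
      exact: isrc (c, false, false).
    exact: itgt (c, false, false).
have := @IH (m - 4) _ (contractE E Q v) (K :\: D) (v |: (X :\: Q)) _ cK' _ _.
rewrite np0 addn0; apply.
- by have := m_gt4; clear; lia.
- by move: cX'; have := m_gt4; move: #|_|; clear; lia.
- by have := m_gt4; clear; lia.
- by apply: edges_in_sub (subsetDl _ _) _; apply: contract_edges_in.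
Qed.

End Maximal.

Lemma even_case : False.
Proof.
have [/forall_inP cen|/forall_inPn [v vX]] := boolP [forall v in X, 0 < ndead [set v]].
  exact: all_centres.
rewrite lt0n negbK => /eqP nv.
pose good S := [&& S \subset X, 0 < #|S|, rank S <= (3 * #|S|).+1 & ndead S < #|S|].
have g0 : good [set v] by rewrite /good sub1set vX cards1 rank1 // nv.
case: (@arg_maxnP _ [set v] good (fun S => #|S|) g0) => S /and4P[SX s0 rS dS] mx.
apply: (no_maximal SX s0 rS dS) => S' S'X rS' dS'; apply: mx.
by rewrite /good S'X rS' dS' (leq_ltn_trans _ dS').
Qed.

End EvenCase.

Theorem girth_boundT (T C : finType) m : girth_bound T C m.
Proof.
have [n] := ubnP m; elim: n m => // n IHn m lt E K X cX cK m0 hE.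
have IH m' : m' < m -> girth_bound T C m'.
  by move=> lt'; apply: IHn; apply: leq_trans lt' _.
have [np|] := posnP (num_parallel E K); last first.
  rewrite card_gt0 => /set0Pn [c]; rewrite inE => /andP[cKc pc].
  exact: bound_parallel IH cX cK hE cKc pc.
rewrite np addn0; case: (boolP (odd m)) => [om|em]; first exact: bound_odd IH om cX cK hE np.
by apply: contrapT => noC; apply: (even_case IH em m0 cX cK hE np noC).
Qed.

Lemma uniq_map_inj (A B : eqType) (f : A -> B) (l : seq A) :
  uniq (map f l) -> {in l &, injective f}.
Proof.
elim: l => //= a l IH /andP[nin /IH inj] x y; rewrite !inE.
case/predU1P => [->|xl]; case/predU1P => [->|yl] // e; last exact: inj.
- by case/negP: nin; rewrite e map_f.
- by case/negP: nin; rewrite -e map_f.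
Qed.

(** * From closed walks to rainbow cycles *)

Section ClosedWalks.
Variables T C : finType.
Implicit Types (E : C -> bool -> T * T) (K : {set C}).

Lemma shorter_closed_walk E K x l y : walk E x l y -> rainbow K l -> ~~ uniq (map (src E) l) ->
  exists z l', [/\ walk E z l' z, rainbow K l', l' != [::] & size l' < size l].
Proof.
elim: l x => //= s l IH x /andP[/eqP sx w] r; rewrite negb_and negbK => /orP[sin|nu].
  have [l1 [s' [l2 [el es _]]]] := src_split sin.
  move: w; rewrite el => /walk_catP [z w1] /= /andP[/eqP ez _].
  exists (src E s), (s :: l1); split=> //.
  - by rewrite /= eqxx -es ez.
  - by move: r; rewrite el -cat_cons => /rainbow_catl.
  - by rewrite /= ltnS size_cat /= addnS ltnS leq_addr.
have rl : rainbow K l by move: r; rewrite -cat1s => /rainbow_catr.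
have [z [l' [h1 h2 h3 h4]]] := IH _ w rl nu.
by exists z, l'; split=> //; apply: ltnW.
Qed.

Lemma simple_closed_walk E K x l : walk E x l x -> rainbow K l -> l != [::] ->
  exists z l', [/\ walk E z l' z, rainbow K l', l' != [::], size l' <= size l &
                   uniq (map (src E) l')].
Proof.
have [n] := ubnP (size l); elim: n x l => // n IH x l lt w r ne.
have [u|nu] := boolP (uniq (map (src E) l)); first by exists x, l.
have [z [l' [h1 h2 h3 h4]]] := shorter_closed_walk w r nu.
have [|z' [l'' [k1 k2 k3 k4 k5]]] := IH z l' _ h1 h2 h3; first exact: leq_trans h4 _.
by exists z', l''; split=> //; apply: leq_trans k4 (ltnW h4).
Qed.

Lemma walk_nth E x l y s0 i : walk E x l y -> i < size l ->
  tgt E (nth s0 l i) = nth y (behead (map (src E) l)) i.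
Proof.
elim: l x i => //= s l IH x [|i] /andP[_ w] lt; last first.
  by rewrite /= (IH _ _ w) // nth_behead.
by case: l w {IH lt} => [|s' l] /= => [/eqP|/andP[/eqP -> _]].
Qed.

Lemma walk_next E x l s : walk E x l x -> uniq (map (src E) l) -> s \in l ->
  next (map (src E) l) (src E s) = tgt E s.
Proof.
move=> w u sl; rewrite next_nth map_f //.
have il : index s l < size l by rewrite index_mem.
have -> : index (src E s) (map (src E) l) = index s l.
  rewrite -{1}(nth_index s sl) -(nth_map s (src E s)) // index_uniq ?size_map //.
rewrite -{3}(nth_index s sl) (walk_nth s w il).
by case: l w sl {u il} => //= s1 l /andP[/eqP -> _] _.
Qed.

End ClosedWalks.

(** * The upper bounds for t = n and t = n - 1 *)

Section Upper.
Variables (V : finType) (C : eqType) (G : sgraph V) (c : {set V} -> C) (x0 : V).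
Hypothesis size2 : classes_of_size2 G c.

Definition classes : {set {set {set V}}} := preim_partition c (edges G).

Lemma classP k : k \in classes -> exists2 e, e \in edges G & k = colour_class G c (c e).
Proof.
case/imsetP => e eG ->; exists e => //; apply/setP => e'; by rewrite !inE eq_sym.
Qed.

Lemma card_classes t : #|edges G| = 2 * t -> #|classes| = t.
Proof.
have u : {in classes, forall k : {set {set V}}, #|k| = 2} by move=> k /classP [e eG ->]; apply: size2.
have := card_uniform_partition u (preim_partitionP c (edges G)).
by rewrite -/classes => -> /eqP; rewrite mulnC eqn_mul2l => /eqP.
Qed.

(** The Boolean is coerced to position 0 or 1 in an enumeration of the two-element class. *)
Definition class_edge (k : {set {set V}}) (b : bool) : {set V} := nth set0 (enum k) b.
Definition class_ends (k : {set {set V}}) (b : bool) : V * V :=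
  (nth x0 (enum (class_edge k b)) 0, nth x0 (enum (class_edge k b)) 1).

Lemma card2_enum (A : finType) (B : {set A}) a : #|B| = 2 ->
  [/\ nth a (enum B) 0 \in B, nth a (enum B) 1 \in B,
      nth a (enum B) 0 != nth a (enum B) 1 & B = [set nth a (enum B) 0; nth a (enum B) 1]].
Proof.
move=> c2; have := enum_uniq (mem B); have := mem_enum (mem B); move: c2; rewrite cardE.
case: (enum B) => [|y [|z []]] //= _ me; rewrite inE andbT => yz.
have yB : y \in B by rewrite -[_ \in B]me !inE eqxx.
have zB : z \in B by rewrite -[_ \in B]me !inE eqxx orbT.
by split=> //; apply/setP => u; rewrite -[LHS]me !inE.
Qed.

Lemma edgeP e : e \in edges G -> exists x y, [/\ e = [set x; y], adj G x y & x != y].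
Proof.
case/imsetP => -[x y]; rewrite inE /= => xy ->; exists x, y; split=> //.
by apply: contraTneq xy => ->; rewrite adj_irrefl.
Qed.

Lemma class_edge_in k b : k \in classes -> class_edge k b \in k.
Proof.
by case/classP => e eG ->; have [] := card2_enum set0 (size2 eG); case: b.
Qed.

Lemma class_edge_edge k b : k \in classes -> class_edge k b \in edges G.
Proof.
move=> kc; have := class_edge_in b kc; have [e eG ek] := classP kc.
by rewrite {2}ek inE => /andP[].
Qed.

Lemma class_edge_neq k : k \in classes -> class_edge k false != class_edge k true.
Proof. by case/classP => e eG ->; have [] := card2_enum set0 (size2 eG). Qed.

Lemma class_colour k k' b b' : k \in classes -> k' \in classes ->
  c (class_edge k b) = c (class_edge k' b') -> k = k'.
Proof.
move=> kc kc' e; have := class_edge_in b kc; have := class_edge_in b' kc'; move: e.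
have [e eG ->] := classP kc; have [e' eG' ->] := classP kc'.
by rewrite !inE => e0 /andP[_ /eqP h1] /andP[_ /eqP h2]; rewrite -h2 e0 h1.
Qed.

Lemma class_endsE k b : k \in classes ->
  [/\ class_edge k b = [set (class_ends k b).1; (class_ends k b).2],
      (class_ends k b).1 != (class_ends k b).2 &
      adj G (class_ends k b).1 (class_ends k b).2].
Proof.
move=> kc; have [x [y [ee axy xy]]] := edgeP (class_edge_edge b kc).
have c2 : #|class_edge k b| = 2 by rewrite ee cards2 xy.
have [h1 h2 h3 h4] := card2_enum x0 c2; split=> //.
rewrite /class_ends /=; move: h1 h2 h3; set u := nth _ _ _; set v := nth _ _ _; rewrite ee !inE.
case/orP => /eqP ->; case/orP => /eqP ->; rewrite ?eqxx // adj_sym //.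
Qed.

Lemma class_not_parallel k : k \in classes -> ~~ parallel class_ends k.
Proof.
move=> kc; apply: contra (class_edge_neq kc).
have [-> _ _] := class_endsE false kc; have [-> _ _] := class_endsE true kc.
by case/orP => /eqP -> //=; rewrite setUC.
Qed.

Lemma step_set s : col s \in classes ->
  [set src class_ends s; tgt class_ends s] = class_edge s.1.1 s.1.2.
Proof.
move=> kc; have [-> _ _] := class_endsE s.1.2 kc.
by rewrite /src /tgt; case: s.2 => //; rewrite setUC.
Qed.

Lemma rcyc_has_cycle B : rcyc class_ends classes B ->
  exists2 j, has_rainbow_cycle G c j & j.*2 <= B.
Proof.
case=> x0' [l0] [w0 r0 n0 sB]; have [x [l [w r n sl u]]] := simple_closed_walk w0 r0 n0.
exists (size l); last by apply: leq_trans sB; rewrite leq_double.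
have lK s : s \in l -> col s \in classes.
  by case/andP: r => _ /allP h sl'; apply: h; apply: map_f.
(* A closed walk of length one is a loop, and one of length two traverses the same edge twice
   because the graph is simple, so it repeats a colour. *)
have sz : 2 < size l.
  case: l w r n {sl u} lK => // s1 [|s2 [|//]] w r _ lK.
    have k1 := lK s1 (mem_head _ _); have [_ ne _] := class_endsE s1.1.2 k1.
    move: w => /= /andP[/eqP h1 /eqP h2]; rewrite -h2 in h1; move: h1 ne.
    by rewrite /src /tgt /col; case: s1.2 => ->; rewrite eqxx.
  have k1 := lK s1 (mem_head _ _); have k2 : col s2 \in classes by apply: lK; rewrite !inE eqxx orbT.
  move: w => /= /and3P[/eqP h1 /eqP h2 /eqP h3].
  have := step_set k1; have := step_set k2; rewrite h2 h3 h1 setUC => -> e.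
  move: r; rewrite /rainbow /= inE => /andP[/andP[/eqP []]].
  by apply: (class_colour (b := s1.1.2) (b' := s2.1.2)) => //; rewrite e.
have nxt s := walk_next w u (s := s).
set p := map (src class_ends) l in u nxt.
have szp : size p == size l by rewrite size_map.
apply/existsP; exists (Tuple szp); rewrite /rainbow_cycle /= size_map sz /=; apply/andP; split.
  apply/andP; split=> //; apply: cycle_from_next => // _ /mapP [s sl' ->]; rewrite nxt //.
  have [_ _ a] := class_endsE s.1.2 (lK s sl'); rewrite /src /tgt.
  by case: s.2 => //; rewrite adj_sym.
rewrite -map_comp.
have -> : map ((fun x => c [set x; next p x]) \o src class_ends) l =
          map (fun s => c (class_edge s.1.1 s.1.2)) l.
  by apply/eq_in_map => s sl' /=; rewrite nxt // step_set // lK.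
have uc : uniq (map (fun s => col s) l) by case/andP: r.
rewrite map_inj_in_uniq; first exact: map_uniq uc.
move=> s s' sl1 sl2 e; apply: (uniq_map_inj uc) => //.
exact: (class_colour (lK s sl1) (lK s' sl2) e).
Qed.

Lemma cycle_of_n_classes : #|edges G| = 2 * #|V| ->
  exists2 j, has_rainbow_cycle G c j & j <= uphalf #|V|.
Proof.
move/card_classes => ck; have V0 : 0 < #|V| by apply/card_gt0P; exists x0.
have hE : edges_in class_ends classes [set: V] by move=> k b _; rewrite !inE.
have np : num_parallel class_ends classes = 0.
  apply: eq_card0 => k; rewrite inE; apply/negP => /andP[kc].
  by apply/negP; apply: class_not_parallel.
have := girth_boundT (cardsT V) ck V0 hE; rewrite np addn0 => /rcyc_has_cycle [j hj le].
by exists j => //; rewrite -leq_double; move: #|V| le; clear; lia.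
Qed.

Lemma cycle_of_pred_n_classes : 1 < #|V| -> #|edges G| = 2 * (#|V| - 1) ->
  exists2 j, has_rainbow_cycle G c j & j <= #|V| - 1.
Proof.
move=> V1 /card_classes ck.
(* Two distinct edges share at most one vertex. Classes of disjoint edges get the default [x0],
   which is harmless: |V| - 1 values cannot cover [V] in any case. *)
pose u k := odflt x0 [pick x | (x \in class_edge k false) && (x \in class_edge k true)].
have [v vu] : exists v, v \notin u @: classes.
  apply/existsP; apply: contraLR (leq_imset_card u classes).
  rewrite negb_exists => /forallP h; rewrite ck -ltnNge.
  have -> : u @: classes = [set: V] by apply/setP => v; rewrite inE; have := h v; rewrite negbK.
  by rewrite cardsT; move: V1; clear; lia.
have vE k : k \in classes -> v \notin class_edge k (v \in class_edge k false).
  move=> kc; case: (boolP (v \in class_edge k false)) => // v0; apply/negP => v1.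
  have : v != u k by apply: contraNneq vu => ->; apply: imset_f.
  rewrite /u; case: pickP => [x /andP[x0' x1]|/(_ v)] /=; last by rewrite v0 v1.
  move=> vx; case/eqP: (class_edge_neq kc).
  have two b : v \in class_edge k b -> x \in class_edge k b -> [set v; x] = class_edge k b.
    move=> vk xk; apply/eqP; rewrite eqEcard subUset !sub1set vk xk cards2 vx /=.
    by have [-> _ _] := class_endsE b kc; rewrite cards2; case: (_ != _).
  by rewrite -(two false) // -(two true).
pose E' k (b : bool) := class_ends k (v \in class_edge k false).
have hE : edges_in E' classes [set~ v].
  move=> k b kc; have := vE k kc; have [-> _ _] := class_endsE (v \in class_edge k false) kc.
  by rewrite !inE negb_or ![v == _]eq_sym => /andP.
have cX : #|[set~ v]| = #|V| - 1 by rewrite cardsC1 subn1.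
have m0 : 0 < #|V| - 1 by rewrite subn_gt0.
have np : num_parallel E' classes <= #|V| - 1.
  by rewrite -ck; apply/subset_leq_card/subsetP => k; rewrite inE => /andP[].
have := girth_boundT cX ck m0 hE.
move/(rcyc_relabel (E := class_ends) (K := classes) (f := fun k b => (k, v \in class_edge k false))).
case/(_ _ _ _)/rcyc_has_cycle => // j hj le.
by exists j => //; move: (#|V| - 1) (num_parallel _ _) np le; clear; lia.
Qed.

End Upper.

Lemma girth_le (V : finType) (C : eqType) (G : sgraph V) (c : {set V} -> C) B :
  (exists2 j, has_rainbow_cycle G c j & j <= B) -> enat_le (rainbow_girth G c) (Some B).
Proof.
case=> j hj le; rewrite /rainbow_girth; case: pselect => [h|[]]; last by exists j.
by case: ex_minnP => k _ /(_ j hj) /leq_trans; apply.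
Qed.

Lemma girth_eq (V : finType) (C : eqType) (G : sgraph V) (c : {set V} -> C) B :
  enat_le (rainbow_girth G c) (Some B) -> (forall j, has_rainbow_cycle G c j -> B <= j) ->
  rainbow_girth G c = Some B.
Proof.
rewrite /rainbow_girth; case: pselect => // h; case: ex_minnP => k hk _ /= le ge.
by congr Some; apply/eqP; rewrite eqn_leq le ge.
Qed.

Lemma girth_None (V : finType) (C : eqType) (G : sgraph V) (c : {set V} -> C) :
  (forall j, ~~ has_rainbow_cycle G c j) -> rainbow_girth G c = None.
Proof. by move=> h; rewrite /rainbow_girth; case: pselect => // e; case: (e) => j hj; have := h j; rewrite hj. Qed.

(** * Extremal examples *)

Section ArcGraph.
Variables (V : finType) (D : {set V}) (g1 g2 : V -> V).
Hypothesis n12 : {in D, forall x, g1 x != g2 x}.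

Definition arc : rel V := fun x y => (x \in D) && ((y == g1 x) || (y == g2 x)).

Hypothesis asym : forall x y, arc x y -> ~~ arc y x.

Lemma arc_sym : symmetric (fun x y => arc x y || arc y x).
Proof. by move=> x y; rewrite orbC. Qed.

Lemma arc_irrefl : irreflexive (fun x y => arc x y || arc y x).
Proof.
by move=> x; rewrite orbb; apply/negP => h; case/negP: (asym h).
Qed.

Definition arc_graph := SGraph arc_sym arc_irrefl.

(** By [asym] an edge has only one tail; sets that are not edges get [None]. *)
Definition tail (e : {set V}) : option V :=
  [pick x in e | [exists y, arc x y && (e == [set x; y])]].

Lemma tail_arc x y : arc x y -> tail [set x; y] = Some x.
Proof.
move=> a; rewrite /tail; case: pickP => [z|/(_ x)]; last first.
  by rewrite set21 /= => /negbT/negP []; apply/existsP; exists y; rewrite a eqxx.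
case/andP => zxy /existsP [w /andP[a' /eqP e]].
have xy : x != y by apply: contraTneq a => ->; apply/negP => h; case/negP: (asym h).
have zw : z != w by apply: contraTneq a' => ->; apply/negP => h; case/negP: (asym h).
have := set21 x y; have := set22 x y; rewrite e !inE.
case/orP => /eqP h1; case/orP => /eqP h2; subst => //; rewrite ?eqxx // in xy zw.
by case/negP: (asym a).
Qed.

Lemma arc_edgeP e : e \in edges arc_graph -> exists x y, arc x y /\ e = [set x; y].
Proof.
case/imsetP => -[x y]; rewrite inE /= => /orP[a|a] ->; first by exists x, y.
by exists y, x; rewrite setUC.
Qed.

Lemma arc_edge x y : arc x y -> [set x; y] \in edges arc_graph.
Proof. by move=> a; apply/imsetP; exists (x, y) => //; rewrite inE /= a. Qed.

Lemma arc_inj x y z : arc x y -> arc x z -> [set x; y] = [set x; z] -> y = z.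
Proof.
move=> a a' e; have := set22 x y; rewrite e !inE => /orP[] /eqP // yx; subst.
by case/negP: (asym a).
Qed.

Lemma arc_class x : x \in D ->
  colour_class arc_graph tail (Some x) = [set [set x; g1 x]; [set x; g2 x]].
Proof.
move=> xD; have a1 : arc x (g1 x) by rewrite /arc xD eqxx.
have a2 : arc x (g2 x) by rewrite /arc xD eqxx orbT.
apply/setP => e; rewrite [LHS]inE [RHS]inE !in_set1; apply/andP/orP.
  case=> /arc_edgeP [y [z [a ->]]]; rewrite tail_arc // => /eqP [yx]; subst y.
  by move: a; rewrite /arc xD => /orP[] /eqP ->; [left|right].
by case=> /eqP ->; rewrite arc_edge ?tail_arc.
Qed.

Lemma card_arc_class x : x \in D -> #|colour_class arc_graph tail (Some x)| = 2.
Proof.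
move=> xD; rewrite arc_class // cards2; suff -> : [set x; g1 x] != [set x; g2 x] by [].
apply: contra (n12 xD) => /eqP e; apply/eqP; apply: arc_inj e; rewrite /arc xD eqxx ?orbT //.
Qed.

Lemma arc_size2 : classes_of_size2 arc_graph tail.
Proof.
move=> e /arc_edgeP [x [y [a ->]]]; rewrite tail_arc //; apply: card_arc_class.
by case/andP: a.
Qed.

Lemma card_arc_edges : #|edges arc_graph| = 2 * #|D|.
Proof.
rewrite (card_uniform_partition (n := 2) _ (preim_partitionP tail (edges arc_graph))).
  rewrite mulnC; congr (2 * _).
  rewrite -(card_in_imset (f := fun x => colour_class arc_graph tail (Some x)) (D := D)).
    apply: eq_card => k; apply/imsetP/imsetP => -[].
      move=> e eG ->; have [x [y [a ee]]] := arc_edgeP eG; exists x; first by case/andP: a.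
      by apply/setP => e'; rewrite !inE ee tail_arc // eq_sym.
    move=> x xD ->; exists [set x; g1 x]; first by apply: arc_edge; rewrite /arc xD eqxx.
    by apply/setP => e'; rewrite !inE tail_arc 1?eq_sym // /arc xD eqxx.
  move=> x y xD yD e; have: [set x; g1 x] \in colour_class arc_graph tail (Some x).
    by rewrite arc_class // !inE eqxx.
  by rewrite e inE tail_arc ?/arc ?xD ?eqxx // => /andP[_ /eqP []].
move=> k /imsetP [e eG ->]; rewrite -(arc_size2 eG).
by apply: eq_card => e'; rewrite !inE eq_sym.
Qed.

(** The tails of the edges are distinct by rainbowness, lie on the cycle, and are as many as its
    vertices, so they exhaust it. *)
Lemma arc_cycle p : rainbow_cycle arc_graph tail p ->
  {in p, forall z, z \in D /\ (g1 z \in p \/ g2 z \in p)}.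
Proof.
case/and3P => _ /andP[cy up] uc.
pose f x := tail [set x; next p x].
have fP x : x \in p -> exists y z, [/\ f x = Some y, arc y z, y \in p & z \in p].
  move=> xp; have := next_cycle cy xp; have nx : next p x \in p by rewrite mem_next.
  rewrite /f; case/orP => a; first by exists x, (next p x); rewrite tail_arc.
  by exists (next p x), x; rewrite setUC tail_arc.
have sub : {subset map f p <= map Some p}.
  by move=> _ /mapP [x xp ->]; have [y [z [-> _ yp _]]] := fP x xp; apply: map_f.
have [|_ e] := uniq_min_size (s1 := map f p) uc sub; first by rewrite !size_map.
move=> z zp; have : Some z \in map f p by rewrite e map_f.
case/mapP => x xp ez; have [y [w [fy /andP[yD gy] yp wp]]] := fP x xp.
move: ez; rewrite fy => -[->]; split=> //.
by case/orP: gy => /eqP <-; [left | right].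
Qed.

End ArcGraph.

Lemma infinite_example n t : 3 <= n -> t <= n - 2 -> rainbow_girth_value n t None.
Proof.
move=> n3 tn; have [|D0 _ cD0] := @subset_of_card 'I_(n - 2) [set: 'I_(n - 2)] t.
  by rewrite cardsT card_ord.
pose V : finType := (bool + 'I_(n - 2))%type.
pose D : {set V} := [set inr x | x in D0].
(* The only heads are two sinks outside [D], so no vertex of a rainbow cycle could have an
   out-neighbour on it. *)
pose g (b : bool) (x : V) : V := inl b.
have n12 : {in D, forall x, g false x != g true x} by [].
have inD b : inl b \notin D by apply/negP => /imsetP [].
have asym x y : arc D (g false) (g true) x y -> ~~ arc D (g false) (g true) y x.
  by case/andP => _ /orP[] /eqP ->; rewrite /arc (negbTE (inD _)).
exists V, (option V), (arc_graph asym), (tail D (g false) (g true)); split.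
- by rewrite card_sum card_bool card_ord; lia.
- by rewrite (card_arc_edges n12) card_imset ?cD0 //; apply: inr_inj.
- exact: arc_size2.
apply: girth_None => j; apply/existsP => -[p cp].
have h := arc_cycle cp.
have [z zp] : exists z, z \in (p : seq V).
  by case/and3P: cp; case: (tval p) => // z q _ _ _; exists z; apply: mem_head.
by have [_ [/h|/h] []] := h z zp; rewrite (negbTE (inD _)).
Qed.

Lemma iter_ordS n (i : 'I_n) k : iter k (@ordS n) i = (i + k) %% n :> nat.
Proof.
elim: k => [|k IH]; first by rewrite addn0 modn_small.
by rewrite iterS /= IH addnS -addn1 modnDml addn1.
Qed.

Lemma ordS_reach n (i j : 'I_n) : exists k, iter k (@ordS n) i = j.
Proof.
exists (n - i + j); apply: val_inj; rewrite /= iter_ordS addnA subnKC 1?ltnW //.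
by rewrite modnDl modn_small.
Qed.

Lemma wheel_example n : 4 <= n ->
  exists (V : finType) (C : eqType) (G : sgraph V) (c : {set V} -> C),
    [/\ #|V| = n, #|edges G| = 2 * (n - 1), classes_of_size2 G c
      & forall j, has_rainbow_cycle G c j -> n - 1 <= j].
Proof.
(* A wheel: each rim vertex points to the next one and to the hub [None]. The hub lies outside [D],
   so a rainbow cycle avoids it and contains the whole rim. *)
move=> n4; pose V : finType := option 'I_(n - 1).
pose g1 (x : V) : V := omap (@ordS _) x; pose g2 (x : V) : V := None.
pose D : {set V} := [set~ None].
have n12 : {in D, forall x, g1 x != g2 x} by case=> // /[!inE].
have asym x y : arc D g1 g2 x y -> ~~ arc D g1 g2 y x.
  rewrite /arc !inE; case: x => // i /= /orP[] /eqP -> //=.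
  rewrite orbF; apply/eqP => -[] /(congr1 val) /= e.
  have := iter_ordS i 2; rewrite /= -e; have := ltn_ord i; move: (nat_of_ord i); clear -n4 => m.
  move=> lt e; have [le|gt] := leqP (n - 1) (m + 2); last by move: e; rewrite modn_small //; lia.
  by move: e; rewrite -(subnK le) modnDr modn_small; lia.
exists V, (option V), (arc_graph asym), (tail D g1 g2); split.
- by rewrite card_option card_ord; lia.
- by rewrite (card_arc_edges n12) cardsC1 card_option card_ord.
- exact: arc_size2.
move=> j /existsP [p cp]; have h := arc_cycle cp.
have h1 i : Some i \in (p : seq V) -> Some (ordS i) \in (p : seq V).
  by case/h => _ [] // /h [] /[!inE].
have [i ip] : exists i, Some i \in (p : seq V).
  case/and3P: (cp); case: (tval p) h => // z q h _ _ _; have [zD _] := h z (mem_head _ _).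
  by case: z zD {h} => [i _|/[!inE]//]; exists i; apply: mem_head.
have all_p k : Some k \in (p : seq V).
  by have [m <-] := ordS_reach i k; elim: m => [|m] //=; apply: h1.
rewrite -(size_tuple p) -[n - 1]card_ord cardE -(size_map Some); apply: uniq_leq_size.
  by rewrite map_inj_uniq ?enum_uniq //; apply: Some_inj.
by move=> _ /mapP [k _ ->].
Qed.

Lemma square_cycle_example n : 5 <= n ->
  exists (V : finType) (C : eqType) (G : sgraph V) (c : {set V} -> C),
    [/\ #|V| = n, #|edges G| = 2 * n, classes_of_size2 G c
      & forall j, has_rainbow_cycle G c j -> uphalf n <= j].
Proof.
(* The square of the n-cycle, directed forwards. Differences up to 4 must be nonzero modulo n to
   exclude opposite arcs, hence 5 <= n. *)
move=> n5; pose V : finType := 'I_n; pose g2 (x : V) := ordS (ordS x).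
have iterN (i : V) k : 0 < k -> k < n -> iter k (@ordS n) i != i.
  move=> k0 kn; apply/eqP => /(congr1 val) /=; rewrite iter_ordS.
  have := ltn_ord i; move: (nat_of_ord i) => m lt.
  have [le|gt] := leqP n (m + k); last by rewrite modn_small //; lia.
  by rewrite -(subnK le) modnDr modn_small; lia.
have n12 : {in [set: V], forall x, ordS x != g2 x}.
  by move=> x _; rewrite eq_sym (iterN _ 1) //; lia.
have asym x y : arc [set: V] (@ordS n) g2 x y -> ~~ arc [set: V] (@ordS n) g2 y x.
  rewrite /arc !inE /= negb_or => /orP[] /eqP ->; rewrite ![x == _]eq_sym.
    by rewrite (iterN x 2) ?(iterN x 3) //; lia.
  by rewrite (iterN x 3) ?(iterN x 4) //; lia.
exists V, (option V), (arc_graph asym), (tail [set: V] (@ordS n) g2); split.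
- by rewrite card_ord.
- by rewrite (card_arc_edges n12) cardsT card_ord.
- exact: arc_size2.
move=> j /existsP [p cp]; have h := arc_cycle cp.
(* Two consecutive vertices off the cycle are the two out-neighbours of the vertex before them,
   which is then off the cycle too; going round, no vertex is left. *)
have cov y : (y \in (p : seq V)) || (ordS y \in (p : seq V)).
  apply: contraT; rewrite negb_or => ny.
  have out k x : iter k (@ordS n) x = y -> (x \notin (p : seq V)) && (ordS x \notin (p : seq V)).
    elim: k x => [|k IH] x; first by move=> /= ->.
    rewrite iterSr => /IH /andP[h1 h2]; rewrite h1 andbT; apply/negP => /h [_ []] xp.
      by rewrite xp in h1.
    by rewrite /g2 in xp; rewrite xp in h2.
  case/and3P: (cp); case ep: (tval p) => [//|z q] _ _ _.
  have [k /out] := ordS_reach z y; rewrite ep mem_head //.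
pose P : {set V} := [set x in (p : seq V)].
have cT : P :|: (@ordS n) @^-1: P = [set: V].
  by apply/setP => x; rewrite !inE cov.
have cP : #|P| <= j by rewrite cardsE; have := card_size (tval p); rewrite size_tuple.
have := cardsT V; rewrite card_ord -cT => e; have : n <= #|P| + #|P|.
  rewrite -{1}e (leq_trans (leq_card_setU _ _)) // card_preimset //; exact: ordS_inj.
by move: #|P| cP; clear; lia.
Qed.

Theorem theorem3p1 (n t : nat) (hn : 3 <= n) (ht : t <= n) :
  [/\ t <= n - 2 -> is_f n t None,
      t = n - 1 -> 2 * t <= 'C(n, 2) -> is_f n t (Some (n - 1))
    & t = n -> 2 * t <= 'C(n, 2) -> is_f n t (Some (uphalf n))].
Proof.
split=> [tn|-> bin|-> bin].
- by split; [exact: infinite_example | case].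
- have upper V (C : eqType) (G : sgraph V) (c : {set V} -> C) : #|V| = n ->
      #|edges G| = 2 * (n - 1) -> classes_of_size2 G c ->
      enat_le (rainbow_girth G c) (Some (n - 1)).
    move=> cV; rewrite -cV => cE s2; apply: girth_le.
    have [x0 _] : exists x : V, true by apply/card_gt0P; rewrite cV; lia.
    by apply: cycle_of_pred_n_classes => //; rewrite cV; lia.
  (* Three vertices have only three pairs, but four edges would be needed. *)
  have n4 : 4 <= n by case: n hn bin {ht upper} => [|[|[|[|n]]]].
  split; last by move=> _ [V] [C] [G] [c] [cV cE s2 <-]; apply: upper.
  have [V [C [G [c [cV cE s2 low]]]]] := wheel_example n4.
  by exists V, C, G, c; split=> //; apply: girth_eq low; apply: upper.
- have upper V (C : eqType) (G : sgraph V) (c : {set V} -> C) : #|V| = n ->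
      #|edges G| = 2 * n -> classes_of_size2 G c ->
      enat_le (rainbow_girth G c) (Some (uphalf n)).
    move=> cV; rewrite -cV => cE s2; apply: girth_le.
    have [x0 _] : exists x : V, true by apply/card_gt0P; rewrite cV; lia.
    exact: cycle_of_n_classes.
  (* For n = 4 eight edges would have to fit into six pairs, and for n = 3 six into three. *)
  have n5 : 5 <= n by case: n hn bin {ht upper} => [|[|[|[|[|n]]]]].
  split; last by move=> _ [V] [C] [G] [c] [cV cE s2 <-]; apply: upper.
  have [V [C [G [c [cV cE s2 low]]]]] := square_cycle_example n5.
  by exists V, C, G, c; split=> //; apply: girth_eq low; apply: upper.
Qed.
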